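(* Let $T$ be a complete dependent theory with monster model $\mathfrak{C}$, and let $A\subseteq\mathfrak{C}$ be a (small) set. An $A$-indiscernible sequence $I$ is Lascar special over $A$ if and only if it is a Morley sequence over $A$.
   Context: Setting: $T$ is a complete theory (classical first-order, or continuous), $T=T^{eq}$, with monster model $\mathfrak{C}$. $T$ is dependent: for every indiscernible sequence $\langle a_i:i<\lambda\rangle$, every formula $\varphi(x,y)$ and every $c$, the limit $\lim_{i<\lambda}\varphi(a_i,c)$ of truth values exists (classically: the truth value is eventually constant). All indiscernible sequences are indexed by infinite linear orders without a last element. A Morley (nonforking) sequence over $A$ is an $A$-indiscernible sequence $\langle a_i:i\in O\rangle$ such that $\mathrm{tp}(a_i/Aa_{<i})$ does not fork over $A$ for every $i\in O$, where $a_{<i}=\langle a_j:j<i\rangle$. An $A$-indiscernible sequence $I$ is Lascar special (weakly special) over $A$ if for any two realizations $I_1,I_2$ of the Lascar strong type $\mathrm{lstp}(I/A)$ there exists $c$ such that both $I_1{}^\frown c$ and $I_2{}^\frown c$ are $A$-indiscernible. (Realizations may have different order types; $A$-indiscernible sequences $I,J$ have the same Lascar strong type over $A$ when some, equivalently any, increasing subsequences of order type $\omega$ of $I$ and of $J$ do.) *)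

(* Defs.v *)
From mathcomp Require Import all_boot all_order all_algebra.
From mathcomp Require Import all_classical all_reals all_analysis.
From Stdlib Require Import Relation_Operators.

Set Implicit Arguments.
Unset Strict Implicit.
Unset Printing Implicit Defensive.

Import Order.TTheory GRing.Theory Num.Theory.
Import numFieldNormedType.Exports.

Local Open Scope classical_set_scope.
Local Open Scope card_scope.
Local Open Scope ring_scope.

(* Cardinals are represented by types: [small K A] reads |A| < |K|. *)
Definition small (K : Type) (T : Type) (A : set T) : Prop :=
  ~~ ([set: K] #<= A).

(* K is the cardinal for which the monster model is saturated and strongly
   homogeneous. *)
Definition uncountable_strong_limit (K : Type) : Prop :=
  small K [set: nat] /\
  forall X : Type, small K [set: X] -> small K [set: set X].

(* Languages are many-sorted, so that T^eq is a theory like any other. *)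

Record lang := Lang {
  sorts : Type;
  fsym : Type;
  far : fsym -> nat;
  fdom : forall f : fsym, 'I_(far f) -> sorts;
  fcod : fsym -> sorts;
  psym : Type;
  par : psym -> nat;
  pdom : forall p : psym, 'I_(par p) -> sorts }.

Definition small_lang (K : Type) (L : lang) : Prop :=
  [/\ small K [set: sorts L], small K [set: fsym L] & small K [set: psym L]].

(* A context is a type X of free variables together with their sorts. *)

Definition ext (S X : Type) (s : X -> S) (t : S) (o : option X) : S :=
  if o is Some x then s x else t.

Definition ext_val (S X : Type) (car : S -> Type) (s : X -> S) (t : S)
    (a : forall x, car (s x)) (m : car t) : forall o, car (ext s t o) :=
  fun o => if o is Some x return car (ext s t o) then a x else m.

Definition no_var (S : Type) (x : void) : S := match x with end.

Definition no_val (S : Type) (car : S -> Type) (x : void) :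
  car (no_var S x) := match x with end.

Inductive term (L : lang) (X : Type) (s : X -> sorts L) : sorts L -> Type :=
| tvar x : term s (s x)
| tapp f : (forall i, term s (fdom (f := f) i)) -> term s (fcod f).

Fixpoint teval (L : lang) (car : sorts L -> Type)
    (fint : forall f : fsym L, (forall i, car (fdom (f := f) i)) -> car (fcod f))
    (X : Type) (s : X -> sorts L) (a : forall x, car (s x))
    (t : sorts L) (u : term s t) : car t :=
  match u with
  | tvar x => a x
  | tapp f v => fint f (fun i => teval fint a (v i))
  end.

Inductive form (L : lang) (X : Type) (s : X -> sorts L) : Type :=
| fbot : form s
| feq t : term s t -> term s t -> form s
| frel p : (forall i, term s (pdom (p := p) i)) -> form s
| fimp : form s -> form s -> form s
| fall t : form (ext s t) -> form s.

Record structure (L : lang) := Structure {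
  car : sorts L -> Type;
  car_inhabited : forall t, inhabited (car t);
  fint : forall f : fsym L, (forall i, car (fdom (f := f) i)) -> car (fcod f);
  pint : forall p : psym L, (forall i, car (pdom (p := p) i)) -> Prop }.

Fixpoint sat (L : lang) (M : structure L) (X : Type) (s : X -> sorts L)
    (phi : form s) : (forall x, car M (s x)) -> Prop :=
  match phi with
  | fbot => fun _ => False
  | feq t u v => fun a => teval (@fint L M) a u = teval (@fint L M) a v
  | frel p v => fun a => pint (fun i => teval (@fint L M) a (v i))
  | fimp phi1 phi2 => fun a => sat phi1 a -> sat phi2 a
  | fall t phi1 => fun a => forall m : car M t, sat phi1 (ext_val a m)
  end.

Definition sentence (L : lang) : Type := form (@no_var (sorts L)).

Definition true_in (L : lang) (M : structure L) (sigma : sentence L) : Prop :=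
  sat sigma (@no_val _ (car M)).

Definition models (L : lang) (M : structure L) (T : set (sentence L)) : Prop :=
  forall sigma, T sigma -> true_in M sigma.

Definition complete_theory (L : lang) (T : set (sentence L)) : Prop :=
  (exists M : structure L, models M T) /\
  forall M N : structure L, models M T -> models N T ->
    forall sigma, true_in M sigma <-> true_in N sigma.

Definition automorphism (L : lang) (M : structure L)
    (g : forall t, car M t -> car M t) : Prop :=
  [/\ forall t, bijective (@g t),
      forall f v, g _ (fint (f := f) v) = fint (fun i => g _ (v i))
    & forall p v, pint (p := p) v <-> pint (fun i => g _ (v i))].

(* Continuous logic: metric structures of diameter at most 1 with [0, 1]-valued
   predicates; the value 0 is truth.  A symbol's modulus D asserts that
   d(x, y) < D(e) implies that the values at x and y are at distance at most e. *)

Record mlang (R : realType) := MLang {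
  mlang_lang :> lang;
  fmod : fsym mlang_lang -> R -> R;
  fmod_gt0 : forall f e, 0 < e -> 0 < fmod f e;
  pmod : psym mlang_lang -> R -> R;
  pmod_gt0 : forall p e, 0 < e -> 0 < pmod p e }.

Definition cube (R : realType) (n : nat) : set 'rV[R]_n :=
  [set v | forall i, 0 <= v ord0 i <= 1].

Definition connective (R : realType) (n : nat) (u : 'rV[R]_n -> R) : Prop :=
  {within @cube R n, continuous u} /\ forall v, cube v -> 0 <= u v <= 1.

Inductive mform (R : realType) (L : mlang R) (X : Type) (s : X -> sorts L) :
    Type :=
| mdst t : term s t -> term s t -> mform s
| mrel p : (forall i, term s (pdom (p := p) i)) -> mform s
| mconn n (u : 'rV[R]_n -> R) : connective u -> ('I_n -> mform s) -> mform s
| msup t : mform (ext s t) -> mform s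
| minf t : mform (ext s t) -> mform s.

Record mstructure (R : realType) (L : mlang R) := MStructure {
  mcar : sorts L -> metricType R;
  mcar_inhabited : forall t, inhabited (mcar t);
  mcar_complete : forall t (F : set_system (mcar t)),
    ProperFilter F -> cauchy F -> exists x : mcar t, F --> x;
  mcar_diam : forall t (x y : mcar t), mdist x y <= 1;
  mfint : forall f : fsym L, (forall i, mcar (fdom (f := f) i)) -> mcar (fcod f);
  mfint_unif : forall f e v w, 0 < e ->
    (forall i, mdist (v i) (w i) < fmod f e) ->
    mdist (mfint (f := f) v) (mfint (f := f) w) <= e;
  mpint : forall p : psym L, (forall i, mcar (pdom (p := p) i)) -> R;
  mpint_bounds : forall p v, 0 <= mpint (p := p) v <= 1;
  mpint_unif : forall p e v w, 0 < e ->
    (forall i, mdist (v i) (w i) < pmod p e) ->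
    `|mpint (p := p) v - mpint (p := p) w| <= e }.

Fixpoint meval (R : realType) (L : mlang R) (M : mstructure L)
    (X : Type) (s : X -> sorts L) (phi : mform s) :
    (forall x, mcar M (s x)) -> R :=
  match phi with
  | mdst t u v => fun a =>
      mdist (teval (car := mcar M) (@mfint R L M) a u)
            (teval (car := mcar M) (@mfint R L M) a v)
  | mrel p v => fun a =>
      mpint (fun i => teval (car := mcar M) (@mfint R L M) a (v i))
  | mconn n u _ psi => fun a => u (\row_i meval (psi i) a)
  | msup t psi => fun a =>
      sup (range (fun m : mcar M t => meval psi (ext_val (car := mcar M) a m)))
  | minf t psi => fun a =>
      inf (range (fun m : mcar M t => meval psi (ext_val (car := mcar M) a m)))
  end.

Definition msentence (R : realType) (L : mlang R) : Type :=
  mform (@no_var (sorts L)).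

Definition mvalue (R : realType) (L : mlang R) (M : mstructure L)
    (sigma : msentence L) : R := meval sigma (@no_val _ (mcar M)).

(* A theory is a set of sentences sigma, read as the conditions sigma = 0. *)
Definition mmodels (R : realType) (L : mlang R) (M : mstructure L)
    (T : set (msentence L)) : Prop :=
  forall sigma, T sigma -> mvalue M sigma = 0.

Definition mcomplete_theory (R : realType) (L : mlang R)
    (T : set (msentence L)) : Prop :=
  (exists M : mstructure L, mmodels M T) /\
  forall M N : mstructure L, mmodels M T -> mmodels N T ->
    forall sigma, mvalue M sigma = mvalue N sigma.

Definition mautomorphism (R : realType) (L : mlang R) (M : mstructure L)
    (g : forall t, mcar M t -> mcar M t) : Prop :=
  [/\ forall t, bijective (@g t),
      forall t (x y : mcar M t), mdist (g t x) (g t y) = mdist x y,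
      forall f v, g _ (mfint (f := f) v) = mfint (fun i => g _ (v i))
    & forall p v, mpint (p := p) v = mpint (fun i => g _ (v i))].

(* The model-theoretic notions, shared by both logics, only refer to the values
   of formulas, with 0 for truth.  A classical formula has value 0 where it holds
   and 1 where it fails. *)

Record semantics (R : realType) := Semantics {
  sem_sort : Type;
  sem_car : sem_sort -> Type;
  formula : forall X : Type, (X -> sem_sort) -> Type;
  value : forall (X : Type) (s : X -> sem_sort),
    formula s -> (forall x, sem_car (s x)) -> R;
  is_aut : (forall t, sem_car t -> sem_car t) -> Prop }.

Definition classical_sem (R : realType) (L : lang) (M : structure L) :
    semantics R :=
  @Semantics R (sorts L) (car M) (@form L)
    (fun X s phi a => if `[< sat phi a >] then 0 else 1) (@automorphism L M).

Definition continuous_sem (R : realType) (L : mlang R) (M : mstructure L) :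
    semantics R :=
  @Semantics R (sorts L) (mcar M) (@mform R L) (@meval R L M)
    (@mautomorphism R L M).

Definition cat_srt (S X Y : Type) (s : X -> S) (s' : Y -> S) (z : X + Y) : S :=
  match z with inl x => s x | inr y => s' y end.

Section ModelTheory.
Context {R : realType} {U : semantics R}.

Definition tup (X : Type) (s : X -> sem_sort U) : Type :=
  forall x, sem_car (s x).

Definition cat_tup (X Y : Type) (s : X -> sem_sort U) (s' : Y -> sem_sort U)
    (a : tup s) (b : tup s') : tup (cat_srt s s') :=
  fun z => match z return sem_car (cat_srt s s' z) with
           | inl x => a x | inr y => b y end.

Definition elt : Type := {t : sem_sort U & sem_car t}.

Definition par_srt (B : set elt) (p : {p : elt | B p}) : sem_sort U :=
  projT1 (sval p).

Definition par_val (B : set elt) : tup (@par_srt B) :=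
  fun p => projT2 (sval p).

Definition formula_over (B : set elt) (X : Type) (s : X -> sem_sort U) : Type :=
  formula (cat_srt s (@par_srt B)).

Definition value_over (B : set elt) (X : Type) (s : X -> sem_sort U)
    (phi : formula_over B s) (a : tup s) : R :=
  value phi (cat_tup a (@par_val B)).

Definition realizes (B : set elt) (X : Type) (s : X -> sem_sort U)
    (a : tup s) (Phi : set (formula_over B s)) : Prop :=
  forall phi, Phi phi -> value_over phi a = 0.

Definition tp (X : Type) (s : X -> sem_sort U) (a : tup s) (B : set elt) :
    set (formula_over B s) :=
  [set phi | value_over phi a = 0].
Arguments tp {X s} a B.

Context (K : Type).

Definition saturated : Prop :=
  forall (B : set elt) (X : Type) (s : X -> sem_sort U)
    (Phi : set (formula_over B s)),
    small K B -> small K [set: X] ->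
    (forall F, F `<=` Phi -> finite_set F -> exists a, realizes a F) ->
    exists a, realizes a Phi.

Definition strongly_homogeneous : Prop :=
  forall (X : Type) (s : X -> sem_sort U) (a b : tup s),
    small K [set: X] -> tp a set0 = tp b set0 ->
    exists g : forall t, sem_car t -> sem_car t,
      is_aut g /\ forall x, g _ (a x) = b x.

Definition monster : Prop := saturated /\ strongly_homogeneous.

Definition endless (d : Order.disp_t) (O : orderType d) : Prop :=
  inhabited O /\ forall i : O, exists j : O, (i < j)%O.

Definition increasing (O O' : Type) (lt : rel O) (lt' : rel O') (f : O -> O') :
    Prop :=
  forall i j, lt i j -> lt' (f i) (f j).

(* The subsequence of I along f, viewed as one long tuple. *)
Definition subtuple (X : Type) (s : X -> sem_sort U) (O J : Type)
    (I : O -> tup s) (f : J -> O) :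
    tup (fun z : J * X => s z.2) :=
  fun z => I (f z.1) z.2.

Definition indiscernible (A : set elt) (X : Type) (s : X -> sem_sort U)
    (O : Type) (lt : rel O) (I : O -> tup s) : Prop :=
  forall (n : nat) (f g : 'I_n -> O),
    increasing (fun i j : 'I_n => (i < j)%N) lt f ->
    increasing (fun i j : 'I_n => (i < j)%N) lt g ->
    tp (subtuple I f) A = tp (subtuple I g) A.

(* I^c is indexed by [option O], with [None] as the last index. *)
Definition lt_last (O : Type) (lt : rel O) : rel (option O) :=
  fun i j => match i, j with
             | Some i', Some j' => lt i' j'
             | Some _, None => true
             | None, _ => false
             end.

Definition append (X : Type) (s : X -> sem_sort U) (O : Type)
    (I : O -> tup s) (c : tup s) (i : option O) : tup s :=
  if i is Some i' then I i' else c.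

(* An infinite ordinal without last element is an endless well-order. *)
Definition dependent : Prop :=
  forall (d : Order.disp_t) (O : orderType d) (X Y : Type)
    (s : X -> sem_sort U) (s' : Y -> sem_sort U) (I : O -> tup s)
    (phi : formula (cat_srt s s')) (c : tup s'),
    small K [set: O] -> small K [set: X] -> small K [set: Y] ->
    endless O -> well_founded (fun i j : O => (i < j)%O) ->
    indiscernible set0 <%O I ->
    exists l : R, forall e, 0 < e ->
      exists i0, forall i, (i0 <= i)%O -> `|value phi (cat_tup (I i) c) - l| < e.

(* The condition phi(x, b) = 0 divides over A. *)
Definition divides (A : set elt) (X Y : Type) (s : X -> sem_sort U)
    (s' : Y -> sem_sort U) (phi : formula (cat_srt s s')) (b : tup s') : Prop :=
  exists J : nat -> tup s',
    [/\ indiscernible A ltn J, J 0%N = b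
      & ~ exists c : tup s, forall i, value phi (cat_tup c (J i)) = 0].

(* A partial type over a small set forks over A if it implies a finite
   disjunction of conditions each of which divides over A. *)
Definition forks (A B : set elt) (X : Type) (s : X -> sem_sort U)
    (p : set (formula_over B s)) : Prop :=
  exists (n : nat) (k : 'I_n -> nat) (s' : forall j, 'I_(k j) -> sem_sort U)
    (phi : forall j, formula (cat_srt s (@s' j))) (b : forall j, tup (@s' j)),
    (forall j, divides A (phi j) (b j)) /\
    forall c, realizes c p -> exists j, value (phi j) (cat_tup c (b j)) = 0.

Definition coords_below (X : Type) (s : X -> sem_sort U) (d : Order.disp_t)
    (O : orderType d) (I : O -> tup s) (i : O) : set elt :=
  [set p | exists j x, (j < i)%O /\ p = existT _ (s x) (I j x)].

Definition morley (A : set elt) (X : Type) (s : X -> sem_sort U)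
    (d : Order.disp_t) (O : orderType d) (I : O -> tup s) : Prop :=
  indiscernible A <%O I /\
  forall i, ~ forks A (tp (I i) (A `|` coords_below I i)).

(* Equality of Lascar strong types over A is the equivalence relation generated
   by starting a common A-indiscernible sequence. *)
Definition lascar1 (A : set elt) (X : Type) (s : X -> sem_sort U)
    (a b : tup s) : Prop :=
  exists J : nat -> tup s,
    [/\ indiscernible A ltn J, J 0%N = a & J 1%N = b].

Definition same_lstp (A : set elt) (X : Type) (s : X -> sem_sort U) :
    tup s -> tup s -> Prop :=
  clos_refl_sym_trans _ (@lascar1 A X s).

Definition same_lstp_seq (A : set elt) (X : Type) (s : X -> sem_sort U)
    (O O' : Type) (lt : rel O) (lt' : rel O')
    (I : O -> tup s) (J : O' -> tup s) : Prop :=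
  exists (f : nat -> O) (g : nat -> O'),
    [/\ increasing ltn lt f, increasing ltn lt' g
      & same_lstp A (subtuple I f) (subtuple J g)].

Definition realizes_lstp (A : set elt) (X : Type) (s : X -> sem_sort U)
    (d d' : Order.disp_t) (O : orderType d) (O' : orderType d')
    (I : O -> tup s) (I' : O' -> tup s) : Prop :=
  [/\ small K [set: O'], endless O', indiscernible A <%O I'
    & same_lstp_seq A <%O <%O I' I].

Definition lascar_special (A : set elt) (X : Type) (s : X -> sem_sort U)
    (d : Order.disp_t) (O : orderType d) (I : O -> tup s) : Prop :=
  indiscernible A <%O I /\
  forall (d1 d2 : Order.disp_t) (O1 : orderType d1) (O2 : orderType d2)
    (I1 : O1 -> tup s) (I2 : O2 -> tup s),
    realizes_lstp A I I1 -> realizes_lstp A I I2 ->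
    exists c : tup s,
      indiscernible A (lt_last <%O) (append I1 c) /\
      indiscernible A (lt_last <%O) (append I2 c).

End ModelTheory.

Arguments monster {R} U K.
Arguments dependent {R} U K.
Arguments elt {R} U.

(* Main.v *)
Require Import Defs.
From mathcomp Require Import all_boot all_order all_algebra.
From mathcomp Require Import all_classical all_reals all_analysis.
From mathcomp Require Import zify ring lra.
From Stdlib Require Import Relation_Operators.

(* Call [U] a logic when its formulas are closed under substitution of variables
   and under comparison of values, and are preserved by automorphisms; classical
   and continuous logic are both instances, and everything else is done for a
   monster model of an arbitrary logic.

   If I is Morley and I1, I2 realize lstp(I/A), then the type of a next entry of
   I1 does not fork over A.  By dependence any violation of Lascar invariance
   divides over A, so that type has a realization c whose type over everything
   relevant is Lascar invariant over A; then c continues I2 because it continues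
   I1.

   Conversely let I be Lascar special.  By dependence, a realization of lstp(I/A)
   has an extension on which the limit value of a given formula phi(x, b) is
   stable under further extension.  Since any two realizations have a common
   continuation, this limit depends only on lstp(b/A).  If phi(x, b) divides over
   A, the limit is therefore bounded away from 0: otherwise the conjugates of
   phi(x, b) along a witness of dividing would be jointly realized. *)

Set Implicit Arguments.
Unset Strict Implicit.
Unset Printing Implicit Defensive.

Import Order.TTheory GRing.Theory Num.Theory.
Import numFieldNormedType.Exports.

Local Open Scope classical_set_scope.
Local Open Scope card_scope.
Local Open Scope ring_scope.

(** * Small sets *)

(** Being nonzero is not a closed condition, so compactness cannot ask for it; both directions must
    replace the avoidance of dividing conditions by closed statements. From Lascar special to
    Morley, [divides_unstable] yields a bound e that depends on phi and b but not on the special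
    sequence. This order of quantifiers matters: the sequence is chosen inside the compactness
    argument, after e, because its first entries come from the finitely many conditions at hand. In
    the other direction Lascar invariance is a conjunction of closed conditions |phi(x, u) - phi(x,
    v)| <= e, each failing only where a dividing condition holds. Lascar special supplies one entry
    after a whole infinite sequence, whereas stability concerns an entry at a finite position of a
    sequence of type omega. [extend_last] bridges the gap: it moves the continuation to any finite
    position without leaving the Lascar class. Sequences are treated as tuples in infinite contexts,
    while forking uses finite parameter tuples; the finite support contained in [val_subst]
    translates between the two. *)

Lemma smallP (K T : Type) (A : set T) :
  small K A <-> ~ exists f : K -> T, injective f /\ forall k, A (f k).
Proof.
rewrite /small; split.
- move=> /negP nKA [f [injf Af]]; apply: nKA.
  apply/card_leP/injfunPex.
  exists (fun k : [set: K] => SigSub (mem_set (Af (val k))) : A) => //.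
  by move=> [x xT] [y yT] _ _ /(congr1 val) /= /injf exy; exact: val_inj.
- move=> nf; apply/negP => /card_leP/injfunPex[f _ injf]; apply: nf.
  exists (fun k => val (f (SigSub (mem_set (I : [set: K] k))))); split.
    move=> x y /val_inj /injf; rewrite !inE => /(_ I I).
    by move=> /(congr1 val).
  by move=> k; exact: set_valP.
Qed.

Lemma small_subset (K T : Type) (A B : set T) : A `<=` B -> small K B -> small K A.
Proof.
move=> AB /smallP nB; apply/smallP => -[f [injf Af]]; apply: nB.
by exists f; split => // k; exact: AB.
Qed.

Lemma small_inj (K X Y : Type) (f : X -> Y) :
  injective f -> small K [set: Y] -> small K [set: X].
Proof.
move=> injf /smallP nY; apply/smallP => -[g [injg _]]; apply: nY.
by exists (f \o g); split => //; exact: inj_comp.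
Qed.

Lemma small_sig (K T : Type) (A : set T) : small K A -> small K [set: {x | A x}].
Proof.
move=> /smallP nA; apply/smallP => -[g [injg _]]; apply: nA.
exists (fun k => sval (g k)); split=> [x y|k]; last exact: (svalP (g k)).
by move=> /eq_sig_hprop h; apply/injg/h => z p q; exact: Prop_irrelevance.
Qed.

Lemma small_image (K X T : Type) (f : X -> T) (A : set T) :
  small K [set: X] -> A `<=` range f -> small K A.
Proof.
move=> /smallP nX Af; apply/smallP => -[g [injg Ag]]; apply: nX.
have /choice[h hP] : forall k, exists x, f x = g k.
  by move=> k; have [x _ <-] := Af _ (Ag k); exists x.
by exists h; split => // x y hxy; apply: injg; rewrite -!hP hxy.
Qed.

(** Comparability of cardinals by Zorn's lemma: a maximal graph of a partial injection is total or
    surjective, since otherwise a pair of missed points could be added. *)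
Lemma injection_total (X Y : Type) :
  (exists f : X -> Y, injective f) \/ (exists f : Y -> X, injective f).
Proof.
pose P : set (set (X * Y)) := [set F | forall p q, F p -> F q -> p.1 = q.1 <-> p.2 = q.2].
have [F [PF maxF]] : exists F, P F /\ forall G, F `<` G -> ~ P G.
  apply: Zorn_bigcup => C CP totC p q [F CF Fp] [G CG Gq].
  have [FG|GF] := totC _ _ CF CG.
  - by apply: (CP _ CG) => //; exact: FG.
  - by apply: (CP _ CF) => //; exact: GF.
have [dom|ndom] := pselect (forall x, exists y, F (x, y)).
  left; have [f fP] := choice dom; exists f => x y fxy.
  by apply/(PF _ _ (fP x) (fP y)).
have [ran|nran] := pselect (forall y, exists x, F (x, y)).
  right; have [f fP] := choice ran; exists f => x y fxy.
  by apply/(PF _ _ (fP x) (fP y)).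
move/existsNP: ndom => [x /forallNP nx]; move/existsNP: nran => [y /forallNP ny].
exfalso; apply: (maxF (F `|` [set (x, y)])).
  split; first by move=> p Fp; left.
  by move=> /(_ (x, y)) FxFy; apply: (nx y); apply: FxFy; right.
move=> [p1 p2] [q1 q2] /= [Fp|[-> ->]] [Fq|[-> ->]] //=.
- exact: PF Fp Fq.
- by split=> e; subst; exfalso; [exact: nx Fp|exact: ny Fp].
- by split=> e; subst; exfalso; [exact: nx Fq|exact: ny Fq].
Qed.

Section SmallTypes.
Context (K : Type) (hK : uncountable_strong_limit K).

Lemma small_nat : small K [set: nat].
Proof. exact: hK.1. Qed.

Lemma small_pow2 (X : Type) : small K [set: X] -> small K [set: set (set X)].
Proof. by move=> /(hK.2 _)/(hK.2 _). Qed.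

(** Kuratowski pairs embed [Y * Y] into the double power set of [Y], so closure under power sets
    replaces cardinal arithmetic. *)
Lemma small_square (Y : Type) : small K [set: Y] -> small K [set: Y * Y].
Proof.
move=> /small_pow2; apply: small_inj (fun p => [set [set p.1]; [set p.1; p.2]]) _.
move=> [a b] [c d] /= e.
have ac : a = c.
  have : [set [set c]; [set c; d]] [set a] by rewrite -e; left.
  by case=> /seteqP[_ h]; apply/esym; [exact: (h c)|apply: (h c); left].
subst c; congr pair.
have h1 : [set [set a]; [set a; d]] [set a; b] by rewrite -e; right.
have h2 : [set [set a]; [set a; b]] [set a; d] by rewrite e; right.
case: h1 => /seteqP[h1 h1'].
  have ba : b = a by apply: h1; right.
  subst b; case: h2 => /seteqP[h2 _].
    by apply/esym/(h2 d); right.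
  by have := h2 d (or_intror erefl) => -[] ->.
have [|//] := h1 b (or_intror erefl).
move=> /= ba; have /= [da|db] := h1' d (or_intror erefl); last by rewrite db.
by rewrite ba da.
Qed.

Lemma small_prod (X Y : Type) :
  small K [set: X] -> small K [set: Y] -> small K [set: X * Y].
Proof.
move=> sX sY; have [[f injf]|[f injf]] := injection_total X Y.
  apply: (small_inj (f := fun p => (f p.1, p.2))) (small_square sY).
  by move=> [a b] [c d] /= [/injf -> ->].
apply: (small_inj (f := fun p => (p.1, f p.2))) (small_square sX).
by move=> [a b] [c d] /= [-> /injf ->].
Qed.

Lemma small_bool : small K [set: bool].
Proof. by apply: (small_inj (f := nat_of_bool)) small_nat => -[] []. Qed.

Lemma small_ord n : small K [set: 'I_n].
Proof. exact: small_inj (@ord_inj n) small_nat. Qed.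

Lemma small_sum (X Y : Type) :
  small K [set: X] -> small K [set: Y] -> small K [set: X + Y].
Proof.
move=> sX sY; have [[f injf]|[f injf]] := injection_total X Y.
  have := small_prod small_bool sY.
  apply: (small_inj (f := fun z => match z with inl x => (true, f x) | inr y => (false, y) end)).
  by move=> [a|a] [b|b] //= [] // => [/injf ->|->].
have := small_prod small_bool sX.
apply: (small_inj (f := fun z => match z with inl x => (true, x) | inr y => (false, f y) end)).
by move=> [a|a] [b|b] //= [] // => [->|/injf ->].
Qed.

Lemma small_setU (T : Type) (A B : set T) : small K A -> small K B -> small K (A `|` B).
Proof.
move=> /small_sig sA /small_sig sB.
apply: (small_image (small_sum sA sB)
  (f := fun z => match z with inl x => sval x | inr y => sval y end)).
move=> x [Ax|Bx]; first by exists (inl (exist _ x Ax)).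
by exists (inr (exist _ x Bx)).
Qed.

End SmallTypes.

(** * Definable functions and types *)

Lemma finite_set_list (T : Type) (F : set T) :
  finite_set F -> exists l : seq T, forall x, F x -> List.In x l.
Proof.
move=> /(@finite_seqP {classic T})[l ->]; exists l => x /=.
elim: l => //= y l IH; rewrite inE => /orP[/eqP->|/IH]; [by left|by right].
Qed.

Definition cast_car (R : realType) (U : semantics R) (t t' : sem_sort U)
  (h : t = t') (m : sem_car t) : sem_car t' := eq_rect t (@sem_car R U) m t' h.

(* [val_subst] is phrased with a relation [E] so that a single induction on
   formulas yields both renaming of variables and finite support. *)
Record logic (R : realType) (U : semantics R) : Prop := Logic {
  val_bounds : forall (X : Type) (s : X -> sem_sort U) (phi : formula s) (a : tup s),
    0 <= value phi a <= 1;
  val_subst : forall (X : Type) (s : X -> sem_sort U) (phi : formula s),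
    exists l : seq X, forall (Y : Type) (s' : Y -> sem_sort U)
      (E : tup s -> tup s' -> Prop),
      (forall x, List.In x l -> exists (y : Y) (h : s' y = s x),
         forall a a', E a a' -> a x = cast_car h (a' y)) ->
      exists psi : formula s', forall a a', E a a' -> value psi a' = value phi a;
  val_zero : forall (X : Type) (s : X -> sem_sort U),
    exists phi : formula s, forall a, value phi a = 0;
  val_dist_le : forall (X : Type) (s : X -> sem_sort U) (phi psi : formula s) (r : R),
    exists chi : formula s, forall a,
      value chi a = 0 <-> `|value phi a - value psi a| <= r;
  val_dist_ge : forall (X : Type) (s : X -> sem_sort U) (phi psi : formula s) (r : R),
    exists chi : formula s, forall a,
      value chi a = 0 <-> r <= `|value phi a - value psi a|;
  aut_bij : forall g, @is_aut R U g -> forall t, bijective (g t);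
  aut_value : forall g, @is_aut R U g ->
    forall (X : Type) (s : X -> sem_sort U) (phi : formula s) (a : tup s),
      value phi (fun x => g _ (a x)) = value phi a }.

Section Definability.
Context {R : realType} {U : semantics R} (LU : logic U).
Implicit Types (A B : set (elt U)).

(** The entries allowed in substitutions: variables, or parameters from [B]. Treating them as
    functions confines the casts between equal sorts to [coordP]. *)
Inductive coordinate B (X : Type) (s : X -> sem_sort U) :
    forall t, (tup s -> sem_car t) -> Prop :=
| coord_var x : coordinate B (fun a : tup s => a x)
| coord_par t (m : sem_car t) : B (existT _ t m) -> coordinate B (fun _ : tup s => m).

Lemma coordP B X (s : X -> sem_sort U) t (f : tup s -> sem_car t) : coordinate B f ->
  exists (w : X + {p | B p}) (h : cat_srt s (@par_srt R U B) w = t),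
    forall a, f a = cast_car h (cat_tup a (@par_val R U B) w).
Proof.
case=> [x|t' m Bm]; first by exists (inl x), erefl.
by exists (inr (exist _ (existT _ t' m) Bm)), erefl.
Qed.

Lemma coord_comp B X (s : X -> sem_sort U) Y (s' : Y -> sem_sort U) t
    (f : tup s -> sem_car t) (e : tup s' -> tup s) :
  coordinate B f -> (forall x, coordinate B (fun a => e a x)) -> coordinate B (fun a => f (e a)).
Proof. by case=> [x|t' m Bm] // _; exact: coord_par. Qed.

Definition definable B X (s : X -> sem_sort U) (f : tup s -> R) : Prop :=
  exists phi : formula_over B s, forall a, value_over phi a = f a.

Lemma definable_value B X (s : X -> sem_sort U) Z (sz : Z -> sem_sort U)
    (phi : formula sz) (e : tup s -> tup sz) :
  (forall z, coordinate B (fun a => e a z)) -> definable B (fun a => value phi (e a)).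
Proof.
move=> ce; have [l /(_ _ (cat_srt s (@par_srt R U B)))] := val_subst LU phi.
move=> /(_ (fun a b => exists c, a = e c /\ b = cat_tup c (@par_val R U B))).
case=> [z _|psi psiP].
  have [w [h hP]] := coordP (ce z); exists w, h => a a' [c [-> ->]]; exact: hP.
by exists psi => a; apply: psiP; exists a.
Qed.

Lemma definable_comp B X (s : X -> sem_sort U) Y (s' : Y -> sem_sort U)
    (f : tup s -> R) (e : tup s' -> tup s) :
  definable B f -> (forall x, coordinate B (fun a => e a x)) ->
  definable B (fun a => f (e a)).
Proof.
move=> [phi phiP] ce.
have [|psi psiP] := @definable_value B _ s' _ _ phi
  (fun a => cat_tup (e a) (@par_val R U B)) _.
  by move=> [x|[[t m] Bm]] /=; [exact: ce|exact: coord_par].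
by exists psi => a; rewrite psiP -phiP.
Qed.

Lemma definable_mono A B X (s : X -> sem_sort U) (f : tup s -> R) :
  A `<=` B -> definable A f -> definable B f.
Proof.
move=> AB [phi phiP].
have [|psi psiP] := @definable_value B _ s _ _ phi
  (fun a => cat_tup a (@par_val R U A)) _.
  by move=> [x|[[t m] Bm]] /=; [exact: coord_var|apply/coord_par/AB].
by exists psi => a; rewrite psiP -phiP.
Qed.

Definition closed_cond B X (s : X -> sem_sort U) (P : tup s -> Prop) : Prop :=
  exists phi : formula_over B s, forall a, P a <-> value_over phi a = 0.

Lemma cond_dist_le B X (s : X -> sem_sort U) (f g : tup s -> R) r :
  definable B f -> definable B g -> closed_cond B (fun a => `|f a - g a| <= r).
Proof.
move=> [phi phiP] [psi psiP]; have [chi chiP] := val_dist_le LU phi psi r.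
by exists chi => a; rewrite -phiP -psiP /value_over chiP.
Qed.

Lemma cond_dist_ge B X (s : X -> sem_sort U) (f g : tup s -> R) r :
  definable B f -> definable B g -> closed_cond B (fun a => r <= `|f a - g a|).
Proof.
move=> [phi phiP] [psi psiP]; have [chi chiP] := val_dist_ge LU phi psi r.
by exists chi => a; rewrite -phiP -psiP /value_over chiP.
Qed.

Lemma definable_bounds B X (s : X -> sem_sort U) (f : tup s -> R) a :
  definable B f -> 0 <= f a <= 1.
Proof. by move=> [phi <-]; exact: val_bounds. Qed.

Lemma definable_zero B X (s : X -> sem_sort U) : definable B (fun _ : tup s => 0).
Proof. by have [phi phiP] := val_zero LU (cat_srt s (@par_srt R U B)); exists phi => a; exact: phiP. Qed.

Lemma cond_le B X (s : X -> sem_sort U) (f : tup s -> R) r :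
  definable B f -> closed_cond B (fun a => f a <= r).
Proof.
move=> df; have [phi phiP] := cond_dist_le r df (definable_zero B s).
exists phi => a; rewrite -phiP subr0 ger0_norm //.
by have /andP[] := definable_bounds a df.
Qed.

Lemma cond_ge B X (s : X -> sem_sort U) (f : tup s -> R) r :
  definable B f -> closed_cond B (fun a => r <= f a).
Proof.
move=> df; have [phi phiP] := cond_dist_ge r df (definable_zero B s).
exists phi => a; rewrite -phiP subr0 ger0_norm //.
by have /andP[] := definable_bounds a df.
Qed.

Definition eqtp A X (s : X -> sem_sort U) (a b : tup s) : Prop :=
  forall f, definable A f -> f a = f b.

Lemma eqtp_sym A X (s : X -> sem_sort U) (a b : tup s) : eqtp A a b -> eqtp A b a.
Proof. by move=> ab f /ab. Qed.

Lemma eqtp_trans A X (s : X -> sem_sort U) (b a c : tup s) :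
  eqtp A a b -> eqtp A b c -> eqtp A a c.
Proof. by move=> ab bc f df; rewrite ab// bc. Qed.

Lemma eqtp_mono A B X (s : X -> sem_sort U) (a b : tup s) :
  A `<=` B -> eqtp B a b -> eqtp A a b.
Proof. by move=> AB ab f /(definable_mono AB)/ab. Qed.

Lemma eqtp_map A X (s : X -> sem_sort U) Y (s' : Y -> sem_sort U)
    (e : tup s -> tup s') (a b : tup s) :
  (forall y, coordinate A (fun a => e a y)) -> eqtp A a b -> eqtp A (e a) (e b).
Proof. by move=> ce ab f df; apply: (ab (fun a => f (e a))); exact: definable_comp. Qed.

(** [tp] only records which formulas vanish, but [f <= f a] and [f a <= f] are themselves such
    conditions over [A], so the zeros determine all values. *)
Lemma realizes_eqtp A X (s : X -> sem_sort U) (a b : tup s) :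
  realizes b (@tp R U _ _ a A) -> eqtp A b a.
Proof.
move=> ba f df; apply/eqP; rewrite eq_le; apply/andP; split.
  have [phi phiP] := cond_le (f a) df; apply/phiP/ba.
  by rewrite /tp/=; apply/phiP.
have [phi phiP] := cond_ge (f a) df; apply/phiP/ba.
by rewrite /tp/=; apply/phiP.
Qed.

Lemma tp_eqP A X (s : X -> sem_sort U) (a b : tup s) :
  @tp R U _ _ a A = @tp R U _ _ b A <-> eqtp A a b.
Proof.
split=> [ab|ab]; first by apply: realizes_eqtp => phi; rewrite -ab.
have e (phi : formula_over A s) : value_over phi a = value_over phi b by apply: ab; exists phi.
by apply/seteqP; split=> phi; rewrite /tp/= e.
Qed.

(** Only the variables in the list from [val_subst] matter, so the right half of the context can be
    cut down to finitely many; forking wants parameter tuples of this kind. *)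
Lemma value_fin_right X (s : X -> sem_sort U) Y (s' : Y -> sem_sort U)
    (phi : formula (cat_srt s s')) :
  exists n (g : 'I_n -> Y) (psi : formula (cat_srt s (fun i => s' (g i)))),
    forall (a : tup s) (b : tup s'),
      value phi (cat_tup a b) = value psi (cat_tup a (fun i => b (g i))).
Proof.
have [l lP] := val_subst LU phi.
pose l' := pmap (fun z : X + Y => if z is inr y then Some y else None) l.
have l'P y : List.In (inr y) l -> List.In y l'.
  rewrite /l'; elim: l {lP l'} => //= z l IH [->/=|/IH]; first by left.
  by case: z => //= ?; right.
exists (size l'), (tnth (in_tuple l')).
have [|psi psiP] := lP _ (cat_srt s (fun i => s' (tnth (in_tuple l') i)))
  (fun c c' => exists a b, c = cat_tup a b /\ c' = cat_tup a (fun i => b (tnth (in_tuple l') i))).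
  move=> [x _|y /l'P yl]; first by exists (inl x), erefl => a a' [b [c [-> ->]]].
  have [i iy] : exists i, tnth (in_tuple l') i = y.
    have [n nl ny] : exists2 n, (n < size l')%N & nth y l' n = y.
      elim: {lP l'P} (l') yl => //= z r IH [->|/IH[n]]; first by exists 0%N.
      by exists n.+1.
    by exists (Ordinal nl); rewrite (tnth_nth y).
  exists (inr i); exists (congr1 s' iy) => a a' [b [c [-> ->]]] /=.
  by case: _ / iy.
by exists psi => a b; apply/esym/psiP; exists a, b.
Qed.

Lemma eqtp_fin A X (s : X -> sem_sort U) (a b : tup s) :
  (forall n (g : 'I_n -> X),
     @eqtp A _ (fun i => s (g i)) (fun i => a (g i)) (fun i => b (g i))) ->
  eqtp A a b.
Proof.
move=> ab f [phi phiP].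
have [l lP] := val_subst LU phi.
(* The parameters move to the left and the tuple to the right, the half that [value_fin_right] cuts
   down. *)
have [|phi' phi'P] := lP _ (cat_srt (@par_srt R U A) s)
  (fun c c' => forall x, match x with
    inl x => c (inl x) = c' (inr x) | inr p => c (inr p) = c' (inl p) end).
  move=> [x|p] _; [exists (inr x)|exists (inl p)]; exists erefl => c c'; first by move=> /(_ (inl x)).
  by move=> /(_ (inr p)).
have phi'E c : value phi' (cat_tup (@par_val R U A) c) = f c.
  by rewrite -phiP; apply: phi'P => -[].
have [n [g [psi psiP]]] := value_fin_right phi'.
rewrite -!phi'E !psiP; apply: (ab n g (fun c => value psi (cat_tup (@par_val R U A) c))).
apply: definable_value => -[[[t m] Am]|i] /=; first exact: coord_par.
exact: coord_var.
Qed.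

End Definability.

(** * Compactness, homogeneity and indiscernible sequences *)

Section Monster.
Context {R : realType} {U : semantics R} (LU : logic U).
Context (K : Type) (hK : uncountable_strong_limit K).
Context (satU : @saturated R U K) (homU : @strongly_homogeneous R U K).
Implicit Types (A B : set (elt U)).

Lemma list_preimage (T J : Type) (f : J -> T) (l : seq T) :
  (forall x, List.In x l -> exists j, f j = x) ->
  exists l' : seq J, forall x, List.In x l -> exists2 j, List.In j l' & f j = x.
Proof.
elim: l => [_|x l IH h]; first by exists [::].
have [|l' l'P] := IH; first by move=> y yl; apply: h; right.
have [j jx] := h x (or_introl erefl).
exists (j :: l') => y [<-|/l'P[k kl ky]]; first by exists j => //; left.
by exists k => //; right.
Qed.

Lemma compactness B X (s : X -> sem_sort U) (J : Type) (P : J -> tup s -> Prop) :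
  small K B -> small K [set: X] -> (forall j, closed_cond B (P j)) ->
  (forall l : seq J, exists a, forall j, List.In j l -> P j a) ->
  exists a, forall j, P j a.
Proof.
move=> sB sX /choice[phi phiP] fin.
have [F FP finF|a aP] := satU (Phi := range phi) sB sX; last first.
  by exists a => j; apply/phiP/aP; exists j.
have [l lP] := finite_set_list finF.
have [l1 l1P] : exists l1 : seq (formula_over B s), forall x, F x <-> List.In x l1.
  exists [seq x <- l | `[< F x >]] => x; split.
    move=> Fx; elim: l {lP} (lP x Fx) => //= y l IH [->|/IH].
      by move/asboolP: (Fx) => ->; left.
    by case: ifP => //= _; right.
  by elim: l {lP} => //= y l IH; case: ifP => //= /asboolP Fy [<-|].
have [|l' l'P] := @list_preimage _ _ phi l1.
  by move=> x /l1P/FP[j _ <-]; exists j.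
have [a aP] := fin l'; exists a => x /l1P/l'P[j jl' <-].
by apply/phiP/aP.
Qed.

(** Each equation is the conjunction of the closed conditions [r j - e <= f j] and [f j <= r j + e]
    for all e > 0; the boolean in [P] selects the side. *)
Lemma compact_approx B X (s : X -> sem_sort U) (J : Type) (f : J -> tup s -> R)
    (r : J -> R) :
  small K B -> small K [set: X] -> (forall j, definable B (f j)) ->
  (forall (l : seq J) (e : R), 0 < e ->
     exists a, forall j, List.In j l -> `|f j a - r j| <= e) ->
  exists a, forall j, f j a = r j.
Proof.
move=> sB sX df fin.
pose P (q : J * {e : R | 0 < e} * bool) (a : tup s) : Prop :=
  if q.2 then f q.1.1 a <= r q.1.1 + sval q.1.2 else r q.1.1 - sval q.1.2 <= f q.1.1 a.
have [|l|a aP] := @compactness B X s _ P sB sX.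
- by move=> [[j e] []]; rewrite /P/=; [exact: (cond_le LU)|exact: (cond_ge LU)].
- have [e [e0 eP]] : exists e : R, 0 < e /\ forall q, List.In q l -> e <= sval q.1.2.
    elim: l => [|q l [e [e0 eP]]]; first by exists 1.
    exists (Num.min e (sval q.1.2)); split.
      by rewrite lt_min e0; exact: svalP q.1.2.
    move=> q' [<-|/eP]; rewrite ge_min ?lexx ?orbT// => ->//.
  have [a aP] := fin [seq q.1.1 | q <- l] e e0; exists a => q ql.
  have := aP q.1.1; rewrite ler_distl => /(_ _)/andP[|].
    by apply/List.in_map_iff; exists q.
  have := eP q ql; rewrite /P; case: (q.2); lra.
exists a => j; apply/eqP; rewrite eq_le; apply/andP; split; apply/ler_addgt0Pl => e e0.
  by have := aP (j, exist _ e e0, true); rewrite /P /= addrC.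
by have := aP (j, exist _ e e0, false); rewrite /P /= lerBlDl.
Qed.

Definition app (g : forall t, sem_car t -> sem_car t) (X : Type)
  (s : X -> sem_sort U) (a : tup s) : tup s := fun x => g _ (a x).

Definition aut_over A (g : forall t, sem_car t -> sem_car t) : Prop :=
  @is_aut R U g /\ forall p, A p -> g _ (projT2 p) = projT2 p.

Lemma app_cat g X (s : X -> sem_sort U) Y (s' : Y -> sem_sort U) (a : tup s) (b : tup s') :
  app g (cat_tup a b) = cat_tup (app g a) (app g b).
Proof. by apply: functional_extensionality_dep => -[x|y]. Qed.

Lemma aut_eqtp A g X (s : X -> sem_sort U) (a : tup s) :
  aut_over A g -> eqtp A (app g a) a.
Proof.
move=> [autg fixg] f [phi phiP]; rewrite -!phiP /value_over -[RHS](aut_value LU autg phi).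
congr (value phi _); apply: functional_extensionality_dep => -[x|[p Ap]] //.
exact/esym/fixg.
Qed.

(** Strong homogeneity is stated without parameters, so [A] is enumerated as a further part of both
    tuples; the automorphism then fixes it pointwise. *)
Lemma homogeneous A X (s : X -> sem_sort U) (a b : tup s) :
  small K A -> small K [set: X] -> eqtp A a b ->
  exists g, aut_over A g /\ app g a = b.
Proof.
move=> sA sX ab.
pose a' := cat_tup a (@par_val R U A); pose b' := cat_tup b (@par_val R U A).
have [||g [autg gP]] := homU (a := a') (b := b').
- exact: small_sum (small_sig sA).
- apply/tp_eqP => // f df; apply: (ab (fun c => f (cat_tup c (@par_val R U A)))).
  apply: definable_comp => //; first exact: definable_mono df.
  by move=> [x|[[t m] Am]]; [exact: coord_var|exact: coord_par].
exists g; split.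
  by split=> // p Ap; exact: (gP (inr (exist _ p Ap))).
by apply: functional_extensionality_dep => x; exact: (gP (inl x)).
Qed.

Lemma indiscP A X (s : X -> sem_sort U) O (lt : rel O) (I : O -> tup s) :
  indiscernible A lt I <-> forall n (f g : 'I_n -> O),
    increasing (fun i j : 'I_n => (i < j)%N) lt f ->
    increasing (fun i j : 'I_n => (i < j)%N) lt g ->
    eqtp A (subtuple I f) (subtuple I g).
Proof. by split=> h n f g fi gi; apply/tp_eqP => //; exact: h. Qed.

Lemma indisc_mono A B X (s : X -> sem_sort U) O (lt : rel O) (I : O -> tup s) :
  A `<=` B -> indiscernible B lt I -> indiscernible A lt I.
Proof.
by move=> AB /indiscP h; apply/indiscP => n f g fi gi; apply: eqtp_mono AB _ => //; exact: h.
Qed.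

Lemma indisc_map A X (s : X -> sem_sort U) Y (s' : Y -> sem_sort U) O (lt : rel O)
    (I : O -> tup s) (e : tup s -> tup s') :
  (forall y, coordinate A (fun a => e a y)) -> indiscernible A lt I ->
  indiscernible A lt (fun o => e (I o)).
Proof.
move=> ce /indiscP h; apply/indiscP => n f g fi gi.
apply: (eqtp_map LU (e := fun (a : tup (fun z : 'I_n * X => s z.2)) (z : 'I_n * Y) =>
  e (fun x => a (z.1, x)) z.2)) (h _ _ _ fi gi).
move=> [i y] /=; apply: (@coord_comp _ _ A _ s _ (fun z : 'I_n * X => s z.2) _ (fun a => e a y)
  (fun a x => a (i, x))); first exact: ce.
by move=> x; exact: (coord_var _ _ (i, x)).
Qed.

Lemma indisc_sub A X (s : X -> sem_sort U) O (lt : rel O) O' (lt' : rel O')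
    (I : O -> tup s) (h : O' -> O) :
  increasing lt' lt h -> indiscernible A lt I -> indiscernible A lt' (fun o => I (h o)).
Proof.
move=> hi /indiscP hI; apply/indiscP => n f g fi gi.
by apply: (hI _ (h \o f) (h \o g)) => i j ij; apply/hi; [exact: fi|exact: gi].
Qed.

Lemma indisc_app A g X (s : X -> sem_sort U) O (lt : rel O) (I : O -> tup s) :
  aut_over A g -> indiscernible A lt I -> indiscernible A lt (fun o => app g (I o)).
Proof.
move=> ag /indiscP hI; apply/indiscP => n f f' fi fi'.
apply: (eqtp_trans (b := subtuple I f)); first exact: aut_eqtp.
apply: (eqtp_trans (b := subtuple I f')); first exact: hI.
exact/eqtp_sym/aut_eqtp.
Qed.

Lemma indisc_eqtp A X (s : X -> sem_sort U) O (lt : rel O) (I I' : O -> tup s) :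
  eqtp A (subtuple I id) (subtuple I' id) -> indiscernible A lt I -> indiscernible A lt I'.
Proof.
move=> II' /indiscP hI; apply/indiscP => n f g fi gi.
have sub h : eqtp A (subtuple I h) (subtuple I' h : tup (fun z : 'I_n * X => s z.2)).
  apply: (eqtp_map LU (e := fun a (z : 'I_n * X) => a (h z.1, z.2))) II' => z.
  exact: (coord_var _ _ (h z.1, z.2)).
apply: (eqtp_trans (eqtp_sym (sub _))).
by apply: eqtp_trans (sub _); exact: hI.
Qed.

Lemma indisc_eqtp1 A X (s : X -> sem_sort U) O (lt : rel O) (I : O -> tup s) o o' :
  indiscernible A lt I -> eqtp A (I o) (I o').
Proof.
move=> /indiscP hI.
have h : eqtp A (subtuple I (fun _ : 'I_1 => o)) (subtuple I (fun _ : 'I_1 => o')).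
  by apply: hI => -[[|i] hi] [[|j] hj].
apply: (eqtp_map LU (e := fun a x => a (@ord0 0, x))) h => x.
exact: (coord_var _ _ (ord0, x)).
Qed.

Lemma lascar1_map A X (s : X -> sem_sort U) Y (s' : Y -> sem_sort U)
    (e : tup s -> tup s') (a b : tup s) :
  (forall y, coordinate A (fun a => e a y)) -> lascar1 A a b -> lascar1 A (e a) (e b).
Proof.
move=> ce [J [iJ <- <-]]; exists (fun i => e (J i)); split=> //.
exact: indisc_map.
Qed.

Lemma lascar1_app A g X (s : X -> sem_sort U) (a b : tup s) :
  aut_over A g -> lascar1 A a b -> lascar1 A (app g a) (app g b).
Proof.
move=> ag [J [iJ <- <-]]; exists (fun i => app g (J i)); split=> //.
exact: indisc_app.
Qed.

Lemma lascar1_eqtp A X (s : X -> sem_sort U) (a b : tup s) :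
  lascar1 A a b -> eqtp A a b.
Proof. by move=> [J [iJ <- <-]]; exact: indisc_eqtp1 iJ. Qed.

Lemma same_lstp_app A g X (s : X -> sem_sort U) (a b : tup s) :
  aut_over A g -> same_lstp A a b -> same_lstp A (app g a) (app g b).
Proof.
move=> ag; elim=> [x y /(lascar1_app ag)|x|x y _|x y z _ + _]; first exact: rst_step.
- exact: rst_refl.
- exact: rst_sym.
- exact: rst_trans.
Qed.

Lemma same_lstp_eqtp A X (s : X -> sem_sort U) (a b : tup s) :
  same_lstp A a b -> eqtp A a b.
Proof.
elim=> [x y /lascar1_eqtp//|x|x y _|x y z _ + _] => //; first exact: eqtp_sym.
exact: eqtp_trans.
Qed.

Definition same_em A X (s : X -> sem_sort U) O (lt : rel O) O' (lt' : rel O')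
    (I : O -> tup s) (I' : O' -> tup s) : Prop :=
  forall n (f : 'I_n -> O) (g : 'I_n -> O'),
    increasing (fun i j : 'I_n => (i < j)%N) lt f ->
    increasing (fun i j : 'I_n => (i < j)%N) lt' g ->
    eqtp A (subtuple I f) (subtuple I' g).

(** Type equality reduces to finitely many variables. Their positions under [g], sorted without
    repetition, form an increasing tuple to which [same_em] applies; injectivity of [g] makes the
    matching positions under [f] well defined. *)
Lemma em_long A X (s : X -> sem_sort U) O (lt : rel O) d (O' : orderType d)
    (I : O -> tup s) (I' : O' -> tup s) (J : Type) (f : J -> O) (g : J -> O') :
  same_em A lt <%O I I' -> injective g ->
  (forall i j, (g i < g j)%O -> lt (f i) (f j)) ->
  eqtp A (subtuple I f) (subtuple I' g).
Proof.
move=> em ginj gf; apply: eqtp_fin => // n h.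
pose u := sort <=%O (undup [seq g (h i).1 | i <- enum 'I_n]).
have su : sorted <%O u by rewrite sort_lt_sorted undup_uniq.
have memu i : g (h i).1 \in u by rewrite mem_sort mem_undup map_f// mem_enum.
have /choice[k kP] : forall i : 'I_(size u), exists j, g j = tnth (in_tuple u) i.
  move=> i; have := mem_tnth i (in_tuple u).
  by rewrite mem_sort mem_undup => /mapP[x _ ->]; exists (h x).1.
have gk : increasing (fun i j : 'I_(size u) => (i < j)%N) <%O (g \o k).
  move=> i j ij /=; rewrite !kP !(tnth_nth (g (k i))) /=.
  by rewrite (sorted_ltn_nth lt_trans) ?inE.
have fk : increasing (fun i j : 'I_(size u) => (i < j)%N) lt (f \o k).
  by move=> i j /gk /gf.
have /choice[q qP] : forall i, exists q, k q = (h i).1.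
  move=> i; have := memu i; rewrite -index_mem => hi; exists (Ordinal hi); apply: ginj.
  by rewrite kP (tnth_nth (g (h i).1)) /= nth_index.
have := em _ _ _ fk gk.
move=> /(eqtp_map LU (e := fun a i => a (q i, (h i).2)))-/(_ _)/wrap[].
  by move=> i; exact: (coord_var _ _ (q i, (h i).2)).
rewrite /subtuple/=.
have -> : (fun i => I (f (k (q i))) (h i).2) = (fun i => I (f (h i).1) (h i).2).
  by apply: functional_extensionality_dep => i; rewrite qP.
have -> // : (fun i => I' (g (k (q i))) (h i).2) = (fun i => I' (g (h i).1) (h i).2).
by apply: functional_extensionality_dep => i; rewrite qP.
Qed.

End Monster.

(** * Stretching indiscernible sequences *)

Section Sequences.
Context {R : realType} {U : semantics R} (LU : logic U).
Context (K : Type) (hK : uncountable_strong_limit K).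
Context (satU : @saturated R U K) (homU : @strongly_homogeneous R U K).
Implicit Types (A B : set (elt U)).

Lemma mem_flatten_In (J : Type) (T : eqType) (F : J -> seq T) (l : seq J) j x :
  List.In j l -> x \in F j -> x \in flatten (map F l).
Proof.
by elim: l => //= k l IH [->|/IH h] xF; rewrite mem_cat ?xF// h ?orbT.
Qed.

Lemma index_sorted_lt d (T : orderType d) (u : seq T) x y :
  sorted <=%O u -> x \in u -> y \in u -> (x < y)%O -> (index x u < index y u)%N.
Proof.
move=> su xu yu xy; rewrite ltnNge; apply/negP => yx.
have := sorted_leq_index le_trans le_refl su _ _ yu xu yx.
by rewrite leNgt xy.
Qed.

Lemma lt_lexi_nat (i q i' q' : nat) :
  (((i, q) : (nat *l nat)%type) < (i', q'))%O = (i < i')%N || (i == i') && (q < q')%N.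
Proof. by rewrite ltEprodlexi /= !leEnat ltEnat /=; apply/idP/idP; lia. Qed.

Lemma same_em_indisc A X (s : X -> sem_sort U) (I : nat -> tup s)
    O (lt : rel O) (E : O -> tup s) :
  same_em A ltn lt I E -> indiscernible A lt E.
Proof.
move=> em; apply/(indiscP LU) => n f g fi gi.
apply: (eqtp_trans (b := subtuple I (@nat_of_ord n))).
  by apply: eqtp_sym; apply: em.
exact: em.
Qed.

Lemma same_em_nat A X (s : X -> sem_sort U) (I : nat -> tup s)
    O (lt : rel O) (E : O -> tup s) :
  indiscernible A ltn I ->
  (forall n (g : 'I_n -> O), increasing (fun i j : 'I_n => (i < j)%N) lt g ->
     eqtp A (subtuple I (@nat_of_ord n)) (subtuple E g)) ->
  same_em A ltn lt I E.
Proof.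
move=> /(indiscP LU) hI h n f g fi gi.
by apply: (eqtp_trans (b := subtuple I (@nat_of_ord n))); [exact: hI|exact: h].
Qed.

(** By compactness finitely many indices of [O] suffice at a time, and these can be sent to their
    ranks, so [I] itself realizes each finite part. *)
Lemma stretch A X (s : X -> sem_sort U) (I : nat -> tup s) d (O : orderType d) :
  small K A -> small K [set: X] -> small K [set: O] ->
  indiscernible A ltn I -> exists E : O -> tup s, same_em A ltn <%O I E.
Proof.
move=> sA sX sO hI.
pose J := {n : nat & ({h : 'I_n -> O | increasing (fun i j : 'I_n => (i < j)%N) <%O h} *
  {f : tup (fun z : 'I_n * X => s z.2) -> R | definable A f})%type}.
pose F (j : J) (a : tup (fun z : O * X => s z.2)) : R :=
  sval (projT2 j).2 (fun z => a (sval (projT2 j).1 z.1, z.2)).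
pose r (j : J) := sval (projT2 j).2 (subtuple I (@nat_of_ord _)).
have [||l e e0|a aP] := @compact_approx _ _ LU _ satU A _ _ J F r sA.
- exact: small_prod.
- move=> [n [[h hi] [f df]]]; rewrite /F/=; apply: (definable_comp LU df) => z.
  exact: (coord_var _ _ (h z.1, z.2)).
- pose G (j : J) := codom (sval (projT2 j).1).
  pose u := sort <=%O (undup (flatten (map G l))).
  exists (fun z => I (index z.1 u) z.2) => -[n [[h hi] [f df]]] jl.
  rewrite /F /r /= [X in f X - _](_ : _ = subtuple I (fun i => index (h i) u))//.
  have memu i : h i \in u.
    rewrite mem_sort mem_undup; apply: mem_flatten_In jl _.
    exact: codom_f.
  have uinc : increasing (fun i j : 'I_n => (i < j)%N) ltn (fun i => index (h i) u).
    by move=> i j ij /=; apply: index_sorted_lt => //; [exact: sort_le_sorted|exact (hi _ _ ij)].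
  move/(indiscP LU) : hI => /(_ _ _ (@nat_of_ord n) uinc).
  by move=> -> //; rewrite subrr normr0 ltW.
exists (fun o x => a (o, x)); apply: same_em_nat => // n g gi f df.
exact/esym/(aP (existT _ n (exist _ g gi, exist _ f df))).
Qed.

(** The positions used by n successive blocks are ordered lexicographically, whichever blocks are
    chosen, so [em_long] compares any two choices. The blocks may be infinite. *)
Lemma rows_indisc A X (s : X -> sem_sort U) d (O : orderType d) d' (Q : orderType d')
    (E : O -> tup s) (rho : nat -> Q -> O) :
  indiscernible A <%O E ->
  (forall i q q', (q < q')%O -> (rho i q < rho i q')%O) ->
  (forall i j q q', (i < j)%N -> (rho i q < rho j q')%O) ->
  indiscernible A ltn (fun i => subtuple E (rho i)).
Proof.
move=> /(indiscP LU) hE hrow hsep; apply/(indiscP LU) => n f g fi gi.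
have lex (h : 'I_n -> nat) : increasing (fun i j : 'I_n => (i < j)%N) ltn h ->
    forall z z' : 'I_n * Q, (rho (h z.1) z.2 < rho (h z'.1) z'.2)%O <->
      (z.1 < z'.1)%N \/ z.1 = z'.1 /\ (z.2 < z'.2)%O.
  move=> hi [i q] [j q'] /=; case: (ltngtP i j) => ij.
  - by split=> _; [left|apply: hsep; exact: hi].
  - split=> [h1|[//|[e]]]; last by move: ij; rewrite e ltnn.
    have h2 := hsep _ _ q' q (hi _ _ ij).
    by have := lt_trans h1 h2; rewrite ltxx.
  - have -> : i = j by exact: val_inj.
    split=> [h1|[//|[_]]]; last exact: hrow.
    right; split=> //; rewrite ltNge le_eqVlt; apply/negP => /orP[/eqP e|/hrow h2].
      by move: h1; rewrite e ltxx.
    by have := lt_trans h1 (h2 _); rewrite ltxx.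
have em : same_em A <%O <%O E E by move=> m f' g'; exact: hE.
have : eqtp A (subtuple E (fun z : 'I_n * Q => rho (f z.1) z.2))
              (subtuple E (fun z : 'I_n * Q => rho (g z.1) z.2)).
  apply: (em_long LU em); last by move=> z z' /(lex _ gi)/(lex _ fi).
  move=> [i q] [j q'] e.
  have n1 : ~ (rho (g i) q < rho (g j) q')%O by rewrite -[rho (g j) q']e ltxx.
  have n2 : ~ (rho (g j) q' < rho (g i) q)%O by rewrite -[rho (g j) q']e ltxx.
  have ij : i = j.
    case: (ltngtP i j) => ij; last exact: val_inj.
      by exfalso; apply: n1; apply/(lex g gi (i, q) (j, q')); left.
    by exfalso; apply: n2; apply/(lex g gi (j, q') (i, q)); left.
  subst j; congr pair.
  case: (ltgtP q q') => // qq.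
    by exfalso; apply: n1; apply/(lex g gi (i, q) (i, q')); right.
  by exfalso; apply: n2; apply/(lex g gi (i, q') (i, q)); right.
move=> /(eqtp_map LU (e := fun a (z : 'I_n * (Q * X)) => a ((z.1, z.2.1), z.2.2))) h.
by apply: h => z; exact: (coord_var _ _ ((z.1, z.2.1), z.2.2)).
Qed.

Lemma rows_lascar A X (s : X -> sem_sort U) d (O : orderType d) d' (Q : orderType d')
    (E : O -> tup s) (rho : nat -> Q -> O) :
  indiscernible A <%O E ->
  (forall i q q', (q < q')%O -> (rho i q < rho i q')%O) ->
  (forall i j q q', (i < j)%N -> (rho i q < rho j q')%O) ->
  lascar1 A (subtuple E (rho 0%N)) (subtuple E (rho 1%N)).
Proof.
by move=> hE hrow hsep; exists (fun i => subtuple E (rho i)); split=> //; exact: rows_indisc.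
Qed.

(* Stretch [I ^ c] to order type [omega^2], with [I] as row 0 and [c] at (1, 0).
   Both the new sequence and [I] start an indiscernible sequence of rows that
   continues with row 2. *)
Lemma extend_last A X (s : X -> sem_sort U) (I : nat -> tup s) (c : tup s) n :
  small K A -> small K [set: X] ->
  indiscernible A ltn I -> indiscernible A (lt_last ltn) (append I c) ->
  exists I' : nat -> tup s,
    [/\ indiscernible A ltn I', forall k, (k < n)%N -> I' k = I k, I' n = c
      & same_lstp A (subtuple I' id) (subtuple I id)].
Proof.
move=> sA sX hI hIc.
have [|E0 em0] := @stretch A X s I _ (nat *l nat)%type sA sX _ hI.
  exact: small_prod (small_nat hK) (small_nat hK).
pose g (o : option nat) : (nat *l nat)%type := if o is Some k then (0%N, k) else (1%N, 0%N).
have em1 : same_em A (lt_last ltn) <%O (append I c) E0.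
  move=> m f f' fi fi'.
  apply: (eqtp_trans (b := subtuple I (@nat_of_ord m))); last exact: em0.
  by move/(indiscP LU): hIc => /(_ m f (Some \o @nat_of_ord m)); exact.
have : eqtp A (subtuple (append I c) id) (subtuple E0 g).
  apply: (em_long LU em1); first by move=> [k|] [k'|] //= [->].
  by move=> [k|] [k'|] //=; rewrite ltEprodlexi.
move=> /eqtp_sym/(homogeneous LU hK homU sA)[|tau [atau tauE]].
  apply: small_prod => //.
  by apply: (small_inj (f := fun o : option nat => if o is Some k then k.+1 else 0%N))
    (small_nat hK) => -[k|] [k'|] // [->].
pose E o := app tau (E0 o).
have hE : indiscernible A <%O E.
  by apply: indisc_app => //; exact: same_em_indisc em0.
have E0k k : E (0%N, k) = I k.
  apply: functional_extensionality_dep => x.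
  by have := congr1 (fun h => h (Some k, x)) tauE.
have E10 : E (1%N, 0%N) = c.
  apply: functional_extensionality_dep => x.
  by have := congr1 (fun h => h (None, x)) tauE.
(* Row 0 of [rho0] keeps n entries of [I] and then runs through row 1 of [E], which puts [c] at
   position n and leaves room for later entries. From index 1 on, [rho0] and [rho1] coincide. *)
pose rho0 (i q : nat) : (nat *l nat)%type :=
  if i is j.+1 then (j.+2, q) else if (q < n)%N then (0%N, q) else (1%N, (q - n)%N).
pose rho1 (i q : nat) : (nat *l nat)%type := if i is j.+1 then (j.+2, q) else (0%N, q).
exists (fun q => E (rho0 0%N q)); split.
- apply: (indisc_sub LU (h := rho0 0%N)) hE => i j ij /=.
  by rewrite /rho0; case: ifP; case: ifP; rewrite lt_lexi_nat; move: ij => /=; lia.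
- by move=> k kn /=; rewrite kn E0k.
- by rewrite /= ltnn subnn.
have row0 (i q q' : nat) : (q < q')%O -> (rho0 i q < rho0 i q')%O.
  rewrite ltEnat /=; case: i => [|i] /=; last by rewrite lt_lexi_nat; lia.
  by case: ifP; case: ifP; rewrite lt_lexi_nat; lia.
have sep0 (i j q q' : nat) : (i < j)%N -> (rho0 i q < rho0 j q')%O.
  case: i j => [|i] [|j] //= ij; repeat case: ifP; rewrite lt_lexi_nat; lia.
have row1 (i q q' : nat) : (q < q')%O -> (rho1 i q < rho1 i q')%O.
  by rewrite ltEnat /=; case: i => [|i] /=; rewrite lt_lexi_nat; lia.
have sep1 (i j q q' : nat) : (i < j)%N -> (rho1 i q < rho1 j q')%O.
  by case: i j => [|i] [|j] //= ij; rewrite lt_lexi_nat; lia.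
apply: (rst_trans _ _ _ (subtuple E (rho0 1%N))).
  exact/rst_step/(rows_lascar hE row0 sep0).
apply: rst_sym.
have -> : subtuple I id = subtuple E (rho1 0%N).
  by apply: functional_extensionality_dep => -[k x]; rewrite /subtuple /= E0k.
exact/rst_step/(rows_lascar hE row1 sep1).
Qed.

End Sequences.

(** * Extracting indiscernible sequences along an ultrafilter *)

(** A nonprincipal ultrafilter with its limit operator; limits exist by compactness of [0, 1]. On
    sequences that leave [0, 1] the value of [ulim] is a dummy. *)
Lemma nat_ultralimit (R : realType) : exists (G : set_system nat) (ulim : (nat -> R) -> R),
  ProperFilter G /\ (forall T : nat, G [set t | (T < t)%N]) /\
  forall F : nat -> R, (forall t, 0 <= F t <= 1) ->
    0 <= ulim F <= 1 /\ forall e : R, 0 < e -> G [set t | `|F t - ulim F| <= e].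
Proof.
have [G [UG FG]] := @ultraFilterLemma nat (@eventually) _.
have PG : ProperFilter G by exact: ultra_proper.
have ex F : exists r : R, (forall t : nat, 0 <= F t <= 1) ->
    0 <= r <= 1 /\ forall e : R, 0 < e -> G [set t | `|F t - r| <= e].
  have [hF|nF] := pselect (forall t : nat, 0 <= F t <= 1); last by exists 0.
  have [|r [r01 Fr]] := @segment_compact R 0 1 (F @ G) _.
    by apply: (@filterE _ G) => t; rewrite /preimage /= in_itv /=; exact: hF.
  exists r => _; split; first by move: r01; rewrite /= in_itv.
  move=> e e0; have nr : nbhs r [set x | `|x - r| <= e].
    by apply/nbhs_ballP; exists e => //= x; rewrite /ball /= distrC => /ltW.
  have [//|nG] := in_ultra_setVsetC [set t | `|F t - r| <= e] UG.
  by have [x []] := Fr (~` [set x | `|x - r| <= e]) _ nG nr.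
have [ulim ulimP] := choice ex.
exists G, ulim; split=> //; split=> // T; apply: FG.
by exists T.+1 => // t /=.
Qed.

Section Ramsey.
Context {R : realType} {G : set_system nat} {ulim : (nat -> R) -> R}.
Context (PG : ProperFilter G) (G_gt : forall T : nat, G [set t | (T < t)%N]).
Context (ulimP : forall F : nat -> R, (forall t, 0 <= F t <= 1) ->
    0 <= ulim F <= 1 /\ forall e : R, 0 < e -> G [set t | `|F t - ulim F| <= e]).

(* The value of a formula along an iterated ultralimit is an average EM-type:
   it plays the part of Ramsey's theorem in [extract]. *)
Fixpoint iter_lim (n : nat) (F : seq nat -> R) : R :=
  if n is n'.+1 then ulim (fun t => iter_lim n' (fun w => F (t :: w))) else F [::].

Lemma iter_lim_bounds n F : (forall w, 0 <= F w <= 1) -> 0 <= iter_lim n F <= 1.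
Proof.
elim: n F => [|n IH] F hF /=; first exact: hF.
by have [] := @ulimP (fun t => iter_lim n (fun w => F (t :: w)))
  (fun t => IH (fun w => F (t :: w)) (fun w => hF (t :: w))).
Qed.

Lemma filter_list (J : Type) (l : seq J) (P : J -> set nat) :
  (forall j, List.In j l -> G (P j)) -> G [set t | forall j, List.In j l -> P j t].
Proof.
elim: l => [_|j l IH h]; first by apply: filterE => t j [].
apply: (filterS (P := P j `&` [set t | forall j, List.In j l -> P j t])).
  by move=> t [Pj Pl] k [<-|/Pl].
by apply: filterI; [apply: h; left|apply: IH => k kl; apply: h; right].
Qed.

(** The sequence is chosen greedily: ultrafilter many next terms t change, for each q whose mask
    keeps this position, the iterated limit by at most [e / 2] when t is substituted for the first
    argument. The remaining terms are chosen with error [e / 2]. Masks let one sequence serve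
    functions of different arities. *)
Lemma iter_lim_approx N (l : seq (seq bool * (seq nat -> R))) (e : R) T :
  0 < e -> (forall q, List.In q l -> size q.1 = N /\ forall w, 0 <= q.2 w <= 1) ->
  exists t : seq nat, [/\ size t = N, path ltn T t
    & forall q, List.In q l -> `|q.2 (mask q.1 t) - iter_lim (count id q.1) q.2| <= e].
Proof.
elim: N l e T => [|N IH] l e T e0 hl.
  exists [::]; split=> // q /hl[/size0nil -> _] /=; by rewrite subrr normr0 ltW.
have e2 : 0 < e / 2 by rewrite divr_gt0.
pose P (q : seq bool * (seq nat -> R)) : set nat := [set t | head false q.1 ->
  `|iter_lim (count id (behead q.1)) (fun w => q.2 (t :: w)) - iter_lim (count id q.1) q.2| <= e / 2].
have GP : G [set t | forall q, List.In q l -> P q t].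
  apply: filter_list => -[m F] /hl[/= sm hF].
  case: m sm => [//|[] m _]; last by apply: filterE.
  rewrite /P /=.
  have [_ /(_ _ e2)] := @ulimP (fun t => iter_lim (count id m) (fun w => F (t :: w)))
    (fun t => iter_lim_bounds _ (fun w => hF (t :: w))).
  by apply: filterS => t /= + _.
have [t [tP Tt]] := filter_ex (filterI GP (G_gt T)).
pose l' := [seq (behead q.1, if head false q.1 then fun w => q.2 (t :: w) else q.2) | q <- l].
have [|t' [st' pt' t'P]] := IH l' (e / 2) t e2.
  move=> q /List.in_map_iff[[m F] [<- /hl[/= sm hF]]] /=.
  by case: m sm => [//|b m [<-]]; split=> // w; case: b => /=.
exists (t :: t'); split; [by rewrite /= st'|by rewrite /= Tt|].
move=> [m F] ql; have [/= sm hF] := hl _ ql.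
have := t'P _ (List.in_map _ _ _ ql); have := tP _ ql.
case: m sm {ql} => [//|[] m _] /=; rewrite /P /=.
  move=> /(_ erefl) h1 h2.
  rewrite (le_trans (ler_distD (iter_lim (count id m) (fun w => F (t :: w))) _ _))//.
  by rewrite [leRHS](splitr e) lerD.
by move=> _ h; rewrite add0n (le_trans h)// ler_pdivrMr// ler_peMr ?ltW// ltr1n.
Qed.

End Ramsey.

Lemma mask_codom n (t : 'I_n -> nat) N (T : seq nat) :
  increasing (fun i j : 'I_n => (i < j)%N) ltn t -> (forall i, (t i < N)%N) ->
  size T = N ->
  mask (mkseq (fun k => k \in codom t) N) T = [seq nth 0%N T (t i) | i <- enum 'I_n].
Proof.
move=> ti tN sT.
have -> : [seq nth 0%N T (t i) | i <- enum 'I_n] = [seq nth 0%N T k | k <- codom t].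
  by rewrite /codom /image_mem -map_comp.
have {1}-> : T = [seq nth 0%N T k | k <- iota 0 N] by rewrite -sT -/(mkseq _ _) mkseq_nth.
rewrite -map_mask; congr map; rewrite /mkseq -filter_mask.
apply: (irr_sorted_eq ltn_trans ltnn).
- exact/sorted_filter/iota_ltn_sorted/ltn_trans.
- rewrite /codom /image_mem.
  apply: (homo_sorted (e := fun i j : 'I_n => (i < j)%N)) => //.
  by have := iota_ltn_sorted 0 n; rewrite -val_enum_ord sorted_map.
- move=> k; rewrite mem_filter mem_iota /= add0n.
  by case: (boolP (k \in codom t)) => //= /codomP[i ->]; exact: tN.
Qed.

(** * Realizing the average EM-type *)

Section ExtractedSequence.
Context {R : realType} {U : semantics R} (LU : logic U).
Context (K : Type) (hK : uncountable_strong_limit K) (satU : @saturated R U K).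

(** The iterated limits [L n f] form an EM-type that is finitely satisfied, up to any error, along
    [e]. A realization is indiscernible because [L n f] does not depend on the indices, and it keeps
    every value that is constant on increasing tuples of [e]. *)
Lemma extract (A : set (elt U)) Z (sz : Z -> sem_sort U) (e : nat -> tup sz) :
  small K A -> small K [set: Z] ->
  exists e' : nat -> tup sz, indiscernible A ltn e' /\
    forall n (f : tup (fun z : 'I_n * Z => sz z.2) -> R) r, definable A f ->
      (forall t : 'I_n -> nat, increasing (fun i j : 'I_n => (i < j)%N) ltn t ->
         f (subtuple e t) = r) ->
      forall t : 'I_n -> nat, increasing (fun i j : 'I_n => (i < j)%N) ltn t ->
        f (subtuple e' t) = r.
Proof.
move=> sA sZ; have [G [ulim [PG [G_gt ulimP]]]] := nat_ultralimit R.
have bnd n (f : tup (fun z : 'I_n * Z => sz z.2) -> R) : definable A f ->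
    forall w, 0 <= f (subtuple e (fun i : 'I_n => nth 0%N w i)) <= 1.
  by move=> df w; exact: (definable_bounds LU _ df).
pose L n (f : tup (fun z : 'I_n * Z => sz z.2) -> R) :=
  @iter_lim R ulim n (fun w => f (subtuple e (fun i : 'I_n => nth 0%N w i))).
pose J := {n : nat & ({h : 'I_n -> nat | increasing (fun i j : 'I_n => (i < j)%N) ltn h} *
  {f : tup (fun z : 'I_n * Z => sz z.2) -> R | definable A f})%type}.
pose F (j : J) (a : tup (fun z : nat * Z => sz z.2)) : R :=
  sval (projT2 j).2 (fun z => a (sval (projT2 j).1 z.1, z.2)).
pose r (j : J) := L _ (sval (projT2 j).2).
have [||l eps eps0|a aP] := @compact_approx _ _ LU _ satU A _ _ J F r sA.
- exact: (small_prod hK (small_nat hK)).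
- move=> [n [[h hi] [f df]]]; rewrite /F/=; apply: (definable_comp LU df) => z.
  exact: (coord_var _ _ (h z.1, z.2)).
- have [N NP] : exists N, forall j, List.In j l -> forall i, (sval (projT2 j).1 i < N)%N.
    elim: l => [|j l [N NP]]; first by exists 0%N.
    exists (maxn N (\max_i (sval (projT2 j).1 i)).+1) => k [<-|kl] i; rewrite leq_max.
      by rewrite ltnS (leq_bigmax i) orbT.
    by rewrite NP.
  pose q (j : J) : seq bool * (seq nat -> R) :=
    (mkseq (fun k => k \in codom (sval (projT2 j).1)) N,
     fun w => sval (projT2 j).2 (subtuple e (fun i : 'I_(projT1 j) => nth 0%N w i))).
  have [|T [sT _ TP]] := @iter_lim_approx _ _ _ PG G_gt ulimP N (map q l) eps 0%N eps0.
    move=> _ /List.in_map_iff[[n [[h hi] [f df]]] [<- _]] /=; rewrite size_mkseq; split=> //.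
    exact: bnd.
  exists (fun z => e (nth 0%N T z.1) z.2) => j jl.
  have := TP _ (List.in_map _ _ _ jl); have := NP _ jl.
  case: j {jl} => n [[h hi] [f df]] /= hN; rewrite /F /r /L /=.
  have -> : count id (mkseq (fun k : nat => k \in codom h) N) = n.
    rewrite -(@size_mask _ _ T) ?size_mkseq// mask_codom// size_map -cardE card_ord //.
  rewrite mask_codom//; congr (`| f _ - _ | <= _).
  apply: functional_extensionality_dep => -[i z]; rewrite /subtuple /=.
  by rewrite (nth_map i) ?size_enum_ord// nth_ord_enum.
have aP' n (f : tup (fun z : 'I_n * Z => sz z.2) -> R) (t : 'I_n -> nat) : definable A f ->
    increasing (fun i j : 'I_n => (i < j)%N) ltn t ->
    f (subtuple (s := sz) (fun k x => a (k, x)) t) = L n f.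
  by move=> df ti; exact: (aP (existT _ n (exist _ t ti, exist _ f df))).
exists (fun k x => a (k, x)); split.
  by apply/(indiscP LU) => n f g fi gi h dh; rewrite !aP'.
move=> n f c df fc t ti; rewrite aP'//; apply/eqP; rewrite -subr_eq0 -normr_le0.
apply/ler_addgt0Pl => eps eps0; rewrite addr0.
(* With the full mask the iterated limit is approximated at an actual increasing tuple of [e], where
   [f] has the constant value [c]. *)
have [|T [sT pT TP]] := @iter_lim_approx _ _ _ PG G_gt ulimP n
  [:: (nseq n true, fun w => f (subtuple e (fun i : 'I_n => nth 0%N w i)))] eps 0%N eps0.
  by move=> _ [<-|//]; rewrite /= size_nseq; split=> //; exact: bnd.
have := TP _ (or_introl erefl); rewrite /= mask_true ?sT// count_nseq mul1n fc.
  by rewrite distrC.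
move=> i j ij /=; have sT' := path_sorted pT.
by rewrite (sorted_ltn_nth ltn_trans) ?inE ?sT.
Qed.

End ExtractedSequence.

(** * Stable extensions in a Lascar class *)

Section Special.
Context {R : realType} {U : semantics R} (LU : logic U).
Context (K : Type) (hK : uncountable_strong_limit K).
Context (satU : @saturated R U K) (homU : @strongly_homogeneous R U K).
Context (depU : @dependent R U K).
Context (A : set (elt U)) (sA : small K A).

Lemma nip_cvg X (s : X -> sem_sort U) Y (s' : Y -> sem_sort U)
    (phi : formula (cat_srt s s')) (b : tup s') (D : nat -> tup s) :
  small K [set: X] -> small K [set: Y] -> indiscernible A ltn D ->
  exists l : R, forall e : R, 0 < e ->
    exists i0 : nat, forall i : nat, (i0 <= i)%N -> `|value phi (cat_tup (D i) b) - l| < e.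
Proof.
move=> sX sY hD; have wf : well_founded (fun i j : nat => (i < j)%O).
  apply: (@Wf_nat.well_founded_lt_compat _ id) => i j ij; apply/ssrnat.ltP.
  by move: ij; rewrite ltEnat.
have en : endless nat by split; [exact: (inhabits 0%N)|move=> i; exists i.+1; exact: ltnSn].
have hD0 : indiscernible set0 (<%O : rel nat) D by apply: (indisc_mono LU _ hD).
have [l lP] := depU phi b (small_nat hK) sX sY en wf hD0.
by exists l => e /lP[i0 i0P]; exists i0 => i ii0; apply: i0P.
Qed.

Section Fixed.
Context (X : Type) (s : X -> sem_sort U) (sX : small K [set: X]).

(* [in_class I0] is the set of realizations, of order type omega, of the Lascar
   strong type of [I0]; [stable I0 I1 n F e r] says that [F] is within [e] of [r]
   on everything that such a realization may put after the first [n] entries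
   of [I1]. *)
Definition in_class (I0 I1 : nat -> tup s) : Prop :=
  indiscernible A ltn I1 /\ same_lstp A (subtuple I1 id) (subtuple I0 id).

Definition agree (n : nat) (I I' : nat -> tup s) : Prop :=
  forall k, (k < n)%N -> I' k = I k.

Definition stable (I0 I1 : nat -> tup s) (n : nat) (F : tup s -> R) (e r : R) : Prop :=
  forall I2, in_class I0 I2 -> agree n I1 I2 ->
  forall m, (n <= m)%N -> `|F (I2 m) - r| <= e.

Definition cvg_on_indisc (F : tup s -> R) : Prop :=
  forall D, indiscernible A ltn D -> exists l : R, forall e : R, 0 < e ->
    exists i0 : nat, forall i : nat, (i0 <= i)%N -> `|F (D i) - l| < e.

Definition special (I0 : nat -> tup s) : Prop :=
  forall I1 I2, in_class I0 I1 -> in_class I0 I2 -> exists c : tup s,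
    indiscernible A (lt_last ltn) (append I1 c) /\
    indiscernible A (lt_last ltn) (append I2 c).

Lemma agree_trans n n' I1 I2 I3 : (n <= n')%N -> agree n I1 I2 -> agree n' I2 I3 -> agree n I1 I3.
Proof.
by move=> nn' h1 h2 k kn; rewrite h2 ?h1// (leq_trans kn).
Qed.

Lemma stable_agree I0 I1 n F e r I2 n' :
  stable I0 I1 n F e r -> (n <= n')%N -> agree n I1 I2 -> stable I0 I2 n' F e r.
Proof.
move=> st nn' ag I3 GI3 ag3 m n'm; apply: st => //; last exact: leq_trans n'm.
exact: agree_trans ag ag3.
Qed.

Lemma stable_le I0 I1 n F e e' r :
  e <= e' -> stable I0 I1 n F e r -> stable I0 I1 n F e' r.
Proof. by move=> ee' st I2 G2 ag m nm; apply: le_trans ee'; exact: st. Qed.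

(* Otherwise one could keep extending so that F oscillates by more than e
   infinitely often along a single indiscernible sequence. *)
Lemma stable_extension I0 I1 n F (e : R) :
  cvg_on_indisc F -> 0 < e -> in_class I0 I1 ->
  exists I2 n' r, [/\ in_class I0 I2, agree n I1 I2, (n <= n')%N & stable I0 I2 n' F e r].
Proof.
move=> cvgF e0 G1; apply: contrapT => nst.
(* A stage is a member of the class with a marked position. The next stage keeps all entries up to
   and including the mark, and its own marked entry changes [F] by more than [e]. *)
pose S := {p : (nat -> tup s) * nat | in_class I0 p.1 /\ agree n I1 p.1 /\ (n <= p.2)%N}.
have step (p : S) : exists q : S, [/\ ((sval p).2 < (sval q).2)%N,
    agree (sval p).2.+1 (sval p).1 (sval q).1 &
    e < `|F ((sval q).1 (sval q).2) - F ((sval p).1 (sval p).2)|].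
  case: p => -[I2 k] /= [G2 [ag nk]].
  apply: contrapT => nq; apply: nst; exists I2, k.+1, (F (I2 k)); split=> //.
    exact: leqW.
  move=> I3 G3 ag3 m km; rewrite leNgt; apply/negP => lt_e; apply: nq.
  have ag' : agree n I1 I3 by apply: agree_trans ag ag3; exact: leqW.
  have nm : (n <= m)%N by rewrite (leq_trans nk)// ltnW.
  by exists (exist _ (I3, m) (conj G3 (conj ag' nm))).
have [nxt nxtP] := choice step.
have S0 : S by exists (I1, n); split=> //; split=> // k.
pose T j := iter j nxt S0.
pose D j := (sval (T j)).1 (sval (T j)).2.
have Tinc : {homo (fun j => (sval (T j)).2) : i j / (i < j)%N >-> (i < j)%N}.
  by apply: homo_ltn => [|j]; [exact: ltn_trans|have [] := nxtP (T j)].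
have Tag j N : (j <= N)%N -> (sval (T N)).1 (sval (T j)).2 = D j.
  elim: N => [|N IH]; first by rewrite leqn0 => /eqP->.
  rewrite leq_eqVlt => /orP[/eqP->//|]; rewrite ltnS => jN.
  rewrite -IH//; have [_ ag _] := nxtP (T N); apply: ag.
  rewrite ltnS; move: jN; rewrite leq_eqVlt => /orP[/eqP->//|/Tinc]; exact: ltnW.
have hD : indiscernible A ltn D.
  apply/(indiscP LU) => m f g fi gi.
  (* Marked entries survive at all later stages, so stage N already contains every entry of [D] that
     f and g select. *)
  pose N := (\max_i f i + \max_i g i)%N.
  have sub (h : 'I_m -> nat) : (forall i, h i <= N)%N ->
      subtuple D h = subtuple (sval (T N)).1 (fun i => (sval (T (h i))).2).
    by move=> hN; apply: functional_extensionality_dep => -[i x]; rewrite /subtuple /= Tag.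
  rewrite !sub; last 2 first.
  - by move=> i; rewrite (leq_trans (leq_bigmax i))// leq_addl.
  - by move=> i; rewrite (leq_trans (leq_bigmax i))// leq_addr.
  have [[hT _] _] := svalP (T N).
  move/(indiscP LU): hT; apply.
    by move=> i j ij; apply/Tinc/fi.
  by move=> i j ij; apply/Tinc/gi.
have [l lP] := cvgF D hD.
have e2 : 0 < e / 2 by rewrite divr_gt0.
have [i0 i0P] := lP _ e2.
have [_ _] := nxtP (T i0); rewrite -/(T i0.+1) -/(D _) -/(D _).
have := i0P i0 (leqnn _); have := i0P i0.+1 (leqnSn _).
rewrite !ltr_norml !ltr_normr => /andP[] ? ? /andP[] ? ?; lra.
Qed.

Lemma stable_family I0 I1 n (l : seq (tup s -> R)) (e : R) :
  (forall F, List.In F l -> cvg_on_indisc F) -> 0 < e -> in_class I0 I1 ->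
  exists I2 n', [/\ in_class I0 I2, agree n I1 I2, (n <= n')%N &
    forall F, List.In F l -> exists r, stable I0 I2 n' F e r].
Proof.
move=> + e0; elim: l => [_ G1|F l IH hl G1]; first by exists I1, n; split.
have [|I2 [n2 [G2 ag2 n12 st2]]] := IH _ G1; first by move=> F' F'l; apply: hl; right.
have [|I3 [n3 [r [G3 ag3 n23 st3]]]] := @stable_extension I0 I2 n2 F e _ e0 G2.
  by apply: hl; left.
exists I3, n3; split=> //; first exact: agree_trans ag2 ag3.
  exact: leq_trans n23.
move=> F' [<-|/st2[r' st']]; first by exists r.
by exists r'; exact: stable_agree st' n23 ag3.
Qed.

(** The common continuation can be placed at any prescribed position of each sequence, in particular
    just where stability begins. *)
Lemma special_merge I0 I1 I2 n1 n2 :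
  special I0 -> in_class I0 I1 -> in_class I0 I2 ->
  exists I1' I2', [/\ in_class I0 I1', in_class I0 I2', agree n1 I1 I1',
    agree n2 I2 I2' & I1' n1 = I2' n2].
Proof.
move=> sp G1 G2; have [c [h1 h2]] := sp _ _ G1 G2.
have [I1' [hI1 a1 c1 l1]] := extend_last LU hK satU homU n1 sA sX G1.1 h1.
have [I2' [hI2 a2 c2 l2]] := extend_last LU hK satU homU n2 sA sX G2.1 h2.
exists I1', I2'; split=> //; [split=> //|split=> //|by rewrite c1 c2].
- exact: rst_trans l1 G1.2.
- exact: rst_trans l2 G2.2.
Qed.

(** At the shared entry the value of [F] is within [e] of both r1 and r2. *)
Lemma stable_merge I0 I1 I2 n1 n2 F e r1 r2 :
  special I0 -> in_class I0 I1 -> in_class I0 I2 ->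
  stable I0 I1 n1 F e r1 -> stable I0 I2 n2 F e r2 -> r2 <= r1 + 2 * e.
Proof.
move=> sp G1 G2 st1 st2.
have [I1' [I2' [G1' G2' a1 a2 e12]]] := special_merge n1 n2 sp G1 G2.
have := st1 _ G1' a1 _ (leqnn _); have := st2 _ G2' a2 _ (leqnn _).
rewrite e12 !ler_norml => /andP[] ? ? /andP[] ? ?; lra.
Qed.

End Fixed.
(* Otherwise carry [I1] along a sequence witnessing dividing, obtaining pairs
   (I' i, c' i) that are A-indiscernible, so that all I' i have the Lascar type
   of [I1].  A further extension of [I1] that is stable for many phi(x, c' i) at
   once shares a continuation with each I' i, hence almost realizes all of them.
   The factor 5 in [e' / 5] adds up these comparisons. *)
Lemma divides_unstable X (s : X -> sem_sort U) k (t : 'I_k -> sem_sort U)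
    (phi : formula (cat_srt s t)) (b : tup t) :
  small K [set: X] -> divides A phi b ->
  exists e : R, 0 < e /\ forall (I0 : nat -> tup s), special I0 ->
    forall I1 n r, in_class I0 I1 ->
      stable I0 I1 n (fun a => value phi (cat_tup a b)) e r -> 2 * e < r.
Proof.
move=> sX [J [hJ J0 nJ]]; apply: contrapT => nst; apply: nJ.
pose B : set (elt U) := [set p | exists i y, p = existT _ (t y) (J i y)].
have sB : small K B.
  apply: (small_image (small_prod hK (small_nat hK) (small_ord hK k))
    (f := fun z => existT _ (t z.2) (J z.1 z.2))).
  by move=> _ [i [y ->]]; exists (i, y).
pose f i (c : tup s) := value phi (cat_tup c (J i)).
apply: (@compact_approx _ _ LU _ satU B _ s nat f (fun=> 0)) => //.
  move=> i; apply: (definable_value LU phi) => -[x|y]; first exact: coord_var.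
  by apply: coord_par; exists i, y.
move=> l e' e'0; pose e := e' / 5.
have e0 : 0 < e by rewrite divr_gt0.
have [I0 [I1 [n [r [sp G1 st1 r2]]]]] : exists I0 I1 n r, [/\ special I0, in_class I0 I1,
    stable I0 I1 n (fun a => value phi (cat_tup a b)) e r & r <= 2 * e].
  apply: contrapT => nex; apply: nst; exists e; split=> // I0 sp I1 n r G1 st1.
  by rewrite ltNge; apply/negP => re; apply: nex; exists I0, I1, n, r.
have /choice[g gP] i : exists g, aut_over A g /\ app g b = J i.
  apply: (homogeneous LU hK homU sA) => //; first exact: small_ord.
  by rewrite -J0; exact: (indisc_eqtp1 LU _ _ hJ).
pose sz := cat_srt (fun z : nat * X => s z.2) t.
pose e0' : tup sz := cat_tup (subtuple I1 id) b.
pose E i : tup sz := app (g i) e0'.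
have EE i y : E i (inr y) = J i y by rewrite -(gP i).2.
have sZ : small K [set: (nat * X) + 'I_k].
  by apply: (small_sum hK); [exact: (small_prod hK (small_nat hK))|exact: small_ord].
(* The automorphisms [g i] were chosen independently, so the pairs [E i] need not be indiscernible.
   Extraction repairs this and keeps the type of a single pair and the type of the sequence of
   second components, both being constant on increasing tuples. *)
have [E' [hE' E'P]] := @extract _ _ LU _ hK satU A _ sz E sA sZ.
have E'0 : eqtp A (E' 0%N) e0'.
  move=> h dh; apply: (E'P 1%N (fun a => h (fun z => a (ord0, z))) (h e0') _ _ (fun=> 0%N)).
  - apply: (definable_comp LU dh) => z; exact: (coord_var _ _ (ord0, z)).
  - by move=> u _; apply: (aut_eqtp LU _ (gP (u ord0)).1).
  - by move=> [[|i] hi] [[|j] hj].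
(* Normalizes the first pair to [I1] and [b] themselves: only there are stability and membership in
   the class of [I0] known. *)
have [tau [atau tauE]] := homogeneous LU hK homU sA sZ E'0.
pose F i := app tau (E' i).
have hF : indiscernible A ltn F by exact: (indisc_app LU atau).
have F0 : F 0%N = e0' by [].
pose c' i : tup t := fun y => F i (inr y).
pose I' i : nat -> tup s := fun k x => F i (inl (k, x)).
(* [c'] and [J] have the same type over [A], so a realization found for the conditions on [c'] can
   be carried over to [J]. *)
have [gJ [agJ gJE]] : exists gJ, aut_over A gJ /\ app gJ (subtuple c' id) = subtuple J id.
  apply: (homogeneous LU hK homU sA) => //.
    exact: (small_prod hK (small_nat hK) (small_ord hK k)).
  have em : same_em A (<%O : rel nat) (<%O : rel nat) c' J.
    move=> m u v ui vi h dh.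
    pose h' (a : tup (fun z : 'I_m * ((nat * X) + 'I_k) => sz z.2)) := h (fun z => a (z.1, inr z.2)).
    have dh' : definable A h'.
      by apply: (definable_comp LU dh) => z; exact: (coord_var _ _ (z.1, inr z.2)).
    have -> : h (subtuple c' u) = h' (subtuple F u) by [].
    have -> : h' (subtuple F u) = h' (subtuple E' u).
      exact: (aut_eqtp LU (subtuple E' u) atau dh').
    apply: (E'P m h') => // w wi; rewrite /h'.
    have -> : (fun z : 'I_m * 'I_k => subtuple E w (z.1, inr z.2)) = subtuple J w.
      by apply: functional_extensionality_dep => -[i y]; rewrite /subtuple /= EE.
    by move/(indiscP LU): hJ => /(_ m w v); exact.
  by apply: (em_long LU em (f := id) (g := id)).
have gJE' i : app gJ (c' i) = J i.
  apply: functional_extensionality_dep => y.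
  by have := congr1 (fun h => h (i, y)) gJE.
have FF i j : eqtp A (F i) (F j) by exact: (indisc_eqtp1 LU _ _ hF).
have I'0 : I' 0%N = I1 := congr1 (fun (h : tup sz) k x => h (inl (k, x))) F0.
have I'lstp i : same_lstp A (subtuple (I' i) id) (subtuple I1 id).
  case: i => [|i]; first by rewrite I'0; exact: rst_refl.
  apply/rst_sym/rst_step.
  (* The multiples of [i.+1] give an indiscernible sequence whose first two terms are [I' 0] and
     [I' i.+1]. *)
  exists (fun j => subtuple (I' (j * i.+1)%N) id); split; [|by rewrite mul0n I'0|by rewrite mul1n].
  apply: (@indisc_map _ _ LU A _ sz _ (fun z : nat * X => s z.2) _ _
    (fun j => F (j * i.+1)%N) (fun a z => a (inl (z.1, z.2)))).
    by move=> z; exact: (coord_var _ _ (inl (z.1, z.2))).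
  by apply: (indisc_sub LU _ hF) => j j' /= jj; rewrite ltn_mul2r.
have GI' i : in_class I0 (I' i).
  split; last exact: rst_trans (I'lstp i) G1.2.
  apply: (indisc_eqtp LU _ G1.1); apply/eqtp_sym.
  by apply: (same_lstp_eqtp LU).
have stI' i : stable I0 (I' i) n (fun a => value phi (cat_tup a (c' i))) e r.
  move=> I2 G2 ag m nm.
  (* An arbitrary automorphism over [A] need not preserve the Lascar class of [I0]. This one does,
     because it maps the member [I' i] to the member [I1]. *)
  have [sg [asg sgE]] := homogeneous LU hK homU sA sZ (FF i 0%N).
  rewrite F0 in sgE.
  have sgc : app sg (c' i) = b.
    by apply: functional_extensionality_dep => y; have := congr1 (fun h => h (inr y)) sgE.
  have sgI j : app sg (I' i j) = I1 j.
    by apply: functional_extensionality_dep => x; have := congr1 (fun h => h (inl (j, x))) sgE.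
  rewrite -(aut_value LU asg.1 phi) -/(app sg _) app_cat sgc.
  apply: (st1 (fun j => app sg (I2 j))) => //.
    split; first exact: (indisc_app LU asg G2.1).
    apply: rst_trans G1.2.
    have -> : subtuple I1 id = app sg (subtuple (I' i) id).
      by apply: functional_extensionality_dep => -[j x]; rewrite /app /subtuple /= -sgI.
    apply: (same_lstp_app LU asg); apply: rst_trans G2.2 _; apply/rst_sym.
    exact: (GI' i).2.
  by move=> j jn; rewrite ag.
have [|I2 [n2 [G2 ag2 nn2 st2]]] := stable_family
  (l := [seq (fun a : tup s => value phi (cat_tup a (c' i))) | i <- l]) n _ e0 G1.
  move=> _ /List.in_map_iff[i [<- _]] D hD.
  by apply: nip_cvg => //; exact: small_ord.
exists (app gJ (I2 n2)) => i il.
have [ri sti] := st2 _ (List.in_map _ _ _ il).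
have ri_r := stable_merge sX sp (GI' i) G2 (stI' i) sti.
have := sti _ G2 (fun _ _ => erefl) _ (leqnn _).
have -> : f i (app gJ (I2 n2)) = value phi (cat_tup (I2 n2) (c' i)).
  by rewrite /f -gJE' -app_cat; exact: (aut_value LU agJ.1 phi).
rewrite subr0 (ger0_norm (proj1 (andP (val_bounds LU _ _)))).
rewrite ler_norml => /andP[_ h].
(* The value is at most [ri + e], where [ri <= r + 2 * e] by merging and [r <= 2 * e] by the choice
   of r. *)
have ee : e' = 5 * e by rewrite /e; field.
lra.
Qed.

End Special.

(** * Lascar special sequences are Morley sequences *)

Section SpecialMorley.
Context {R : realType} {U : semantics R} (LU : logic U).
Context (K : Type) (hK : uncountable_strong_limit K).
Context (satU : @saturated R U K) (homU : @strongly_homogeneous R U K).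
Context (depU : @dependent R U K).
Context (A : set (elt U)) (sA : small K A).
Context (X : Type) (s : X -> sem_sort U) (sX : small K [set: X]).
Context (d : Order.disp_t) (O : orderType d) (sO : small K [set: O]) (enO : endless O).

Lemma In_enum (T : finType) (x : T) : List.In x (enum T).
Proof.
have := mem_enum T x; rewrite inE; elim: (enum T) => //= y l IH.
by rewrite inE => /orP[/eqP->|/IH]; [left|right].
Qed.

Lemma exists_above (o : O) : exists h : nat -> O,
  h 0%N = o /\ forall i j, (i < j)%N -> (h i < h j)%O.
Proof.
have [nxt nxtP] := choice enO.2; exists (fun k => iter k nxt o); split=> //.
by apply: (@homo_ltn O (fun k => iter k nxt o) _ lt_trans) => k; exact: nxtP.
Qed.

(** A formula mentions finitely many entries of [I], collected in [lo]. The conclusion allows any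
    [h] that covers [lo], so that finitely many formulas can share one [h]. *)
Lemma formula_below (I : O -> tup s) i (phi : formula_over (A `|` coords_below I i) s) :
  exists lo : seq O, (forall o, o \in lo -> (o < i)%O) /\
    forall c n (h : 'I_n -> O), (forall o, o \in lo -> exists y, h y = o) ->
      eqtp A (cat_tup c (subtuple I h)) (cat_tup (I i) (subtuple I h)) ->
      value_over phi c = value_over phi (I i).
Proof.
have [m [g [psi psiP]]] := value_fin_right LU phi.
have coords p : (A `|` coords_below I i) p -> exists lo : seq O,
    (forall o, o \in lo -> (o < i)%O) /\
    forall n (h : 'I_n -> O), (forall o, o \in lo -> exists y, h y = o) ->
    exists f : tup (cat_srt s (fun z : 'I_n * X => s z.2)) -> sem_car (projT1 p),
      coordinate A f /\ forall c, f (cat_tup c (subtuple I h)) = projT2 p.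
  case: p => t v [Av|[q [x [qi e]]]].
    by exists [::]; split=> // n h _; exists (fun=> v); split=> //; exact: coord_par.
  exists [:: q]; split=> [p'|n h /(_ q)]; first by rewrite inE => /eqP->.
  rewrite inE => /(_ (eqxx _))[y hy].
  rewrite e; exists (fun a => a (inr (y, x))); split.
    exact: (coord_var A (cat_srt s (fun z : 'I_n * X => s z.2)) (inr (y, x))).
  by move=> c /=; rewrite /subtuple /= hy.
have /choice[lo loP] := fun i' : 'I_m => coords _ (svalP (g i')).
exists (flatten [seq lo i' | i' <- enum 'I_m]); split.
  by move=> o /flattenP[_ /mapP[i' _ ->]]; exact: (loP i').1.
move=> c n h hcov ch.
have fex i' := cid ((loP i').2 n h (fun o ol => hcov o
  (mem_flatten_In (In_enum i') ol))).
pose f i' := projT1 (fex i'); have fP i' := projT2 (fex i').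
rewrite /value_over !psiP.
pose e (a : tup (cat_srt s (fun z : 'I_n * X => s z.2))) :
  tup (cat_srt s (fun i' => @par_srt R U (A `|` coords_below I i) (g i'))) :=
  cat_tup (fun x => a (inl x)) (fun i' => f i' a).
have eE c' : cat_tup c' (fun i' => @par_val R U (A `|` coords_below I i) (g i')) =
    e (cat_tup c' (subtuple I h)).
  apply: functional_extensionality_dep => -[x|i'] //=.
  exact/esym/(fP i').2.
rewrite !eE; apply: (ch (fun a => value psi (e a))).
apply: (definable_value LU) => -[x|i'] /=.
  exact: (coord_var A (cat_srt s (fun z : 'I_n * X => s z.2)) (inl x)).
exact: (fP i').1.
Qed.

Lemma lascar_special_special (I : O -> tup s) (f : nat -> O) :
  increasing ltn <%O f -> lascar_special K A I -> special A (fun k => I (f k)).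
Proof.
move=> fi [hI sp] I1 I2 [h1 l1] [h2 l2].
have en : endless nat by split; [exact: (inhabits 0%N)|move=> i; exists i.+1; exact: ltnSn].
apply: (sp _ _ nat nat).
- by split=> //; [exact: small_nat|exists id, f; split].
- by split=> //; [exact: small_nat|exists id, f; split].
Qed.

Lemma exists_le_list (l : seq R) : (forall x, x \in l -> 0 < x) ->
  exists e : R, 0 < e /\ forall x, x \in l -> e <= x.
Proof.
elim: l => [_|x l IH h]; first by exists 1.
have [|e [e0 eP]] := IH; first by move=> y yl; apply: h; rewrite inE yl orbT.
exists (Num.min e x); split; first by rewrite lt_min e0 h// inE eqxx.
move=> y; rewrite inE ge_min => /orP[/eqP->|/eP->//]; by rewrite lexx orbT.
Qed.

Lemma cond_zero B Y (s' : Y -> sem_sort U) (f : tup s' -> R) :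
  definable B f -> closed_cond B (fun a => f a = 0).
Proof. by move=> [phi phiP]; exists phi => a; rewrite phiP. Qed.

(* If dividing formulas phi j(x, b j) covered tp(I i / A I_{<i}), then only a
   finite part I_{u} of I_{<i} would matter.  A stable extension of
   I_{u} ^ I_i ^ ... contains an entry c with tp(c / A I_{u}) = tp(I_i / A I_{u})
   at which all phi j(x, b j) are bounded away from 0. *)
Lemma lascar_special_morley (I : O -> tup s) :
  indiscernible A <%O I -> lascar_special K A I -> morley A I.
Proof.
move=> hI sp; split=> // i [m [k [t [phi [b [dvd cover]]]]]].
have /choice[ej ejP] j := divides_unstable LU hK satU homU depU sA sX (dvd j).
have [|e [e0 eP]] := @exists_le_list (codom ej).
  by move=> _ /codomP[j ->]; exact: (ejP j).1.
pose F j (a : tup s) := value (phi j) (cat_tup a (b j)).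
pose B0 : set (elt U) := A `|` coords_below I i.
pose B1 : set (elt U) := [set p | exists j y, p = existT _ (t j y) (b j y)].
have sB1 : small K B1.
  apply: (small_image (X := {j : 'I_m & 'I_(k j)})
    (f := fun z => existT _ (t _ (projT2 z)) (b _ (projT2 z)))).
    exact: small_inj (pcan_inj pickleK) (small_nat hK).
  by move=> _ [j [y ->]]; exists (existT _ j y).
have sB0 : small K B0.
  apply: (small_setU hK sA).
  apply: (small_image (small_prod hK sO sX) (f := fun z => existT _ (s z.2) (I z.1 z.2))).
  by move=> _ [q [x [_ ->]]]; exists (q, x).
(* The closed bounds [e <= F j a] stand for [F j a <> 0]; a point satisfying all of [P] contradicts
   [cover]. *)
pose P (q : {phi : formula_over B0 s | value_over phi (I i) = 0} + 'I_m) (a : tup s) : Prop :=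
  match q with inl phi => value_over (sval phi) a = 0 | inr j => e <= F j a end.
have [||l|c cP] := @compactness _ _ _ satU (B0 `|` B1) _ s _ P _ sX.
- exact: small_setU.
- move=> [[ph ph0]|j] /=.
    apply: cond_zero; apply: (definable_mono LU (A := B0)); first by move=> x; left.
    by exists ph.
  apply: (cond_ge LU); apply: (definable_value LU) => -[x|y] /=; first exact: coord_var.
  by apply: coord_par; right; exists j, y.
- have [lo [loi loP]] : exists lo : seq O, (forall o, o \in lo -> (o < i)%O) /\
      forall q, List.In q l -> if q is inl ph then
        forall c n (h : 'I_n -> O), (forall o, o \in lo -> exists y, h y = o) ->
        eqtp A (cat_tup c (subtuple I h)) (cat_tup (I i) (subtuple I h)) ->
        value_over (sval ph) c = value_over (sval ph) (I i) else True.
    elim: l => [|q l [lo [loi loP]]]; first by exists [::].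
    case: q => [ph|j]; last by exists lo; split=> // q [<-|/loP].
    have [lo' [loi' loP']] := formula_below (sval ph).
    exists (lo' ++ lo); split.
      by move=> o; rewrite mem_cat => /orP[/loi'|/loi].
    move=> q [<-|/loP].
      by move=> c n h hc; apply: loP' => o ol; apply: hc; rewrite mem_cat ol.
    case: q => // ph' h' c n h hc; apply: h' => o ol; apply: hc.
    by rewrite mem_cat ol orbT.
  pose u := sort <=%O (undup lo); pose q := size u.
  have su : sorted <%O u by rewrite sort_lt_sorted undup_uniq.
  have ui o : o \in u -> (o < i)%O by rewrite mem_sort mem_undup; exact: loi.
  have [h0 [h00 h0i]] := exists_above i.
  (* The finitely many relevant indices come first, i itself sits at position q, and an increasing
     sequence above i follows. *)
  pose f0 n := if (n < q)%N then nth i u n else h0 (n - q)%N.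
  have f0i : increasing ltn <%O f0.
    move=> x y xy; rewrite /f0; case: ifP => xq; case: ifP => yq.
    - by rewrite (sorted_ltn_nth lt_trans) ?inE.
    - apply: (lt_le_trans (ui _ (mem_nth _ xq))).
      rewrite -h00 le_eqVlt; case: (posnP (y - q)%N) => [->|/h0i->]; first by rewrite eqxx.
      by rewrite orbT.
    - by move: xy xq yq => /=; lia.
    - by apply: h0i; move: xy xq yq => /=; lia.
  pose I0 n := I (f0 n).
  have G0 : in_class A I0 I0 by split; [exact: (indisc_sub LU f0i)|exact: rst_refl].
  have sp0 : special A I0 := lascar_special_special f0i sp.
  have cvgF G : List.In G [seq F j | j <- enum 'I_m] -> cvg_on_indisc A G.
    move=> /List.in_map_iff[j [<- _]] D hD.
    exact: (nip_cvg LU hK depU (phi j) (b j) sX (small_ord hK _) hD).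
  have [I1 [n1 [G1 ag1 qn1 st1]]] := stable_family LU q cvgF e0 G0.
  exists (I1 n1) => -[[ph ph0]|j] ql /=.
    pose h (y : 'I_q) := I0 y.
    have := loP _ ql => /(_ (I1 n1) q (fun y : 'I_q => f0 y)) /= -> //.
      move=> o ol; have : o \in u by rewrite mem_sort mem_undup.
      rewrite -index_mem => ou; exists (Ordinal ou); rewrite /f0 /= ou nth_index//.
      by rewrite -index_mem.
    (* As [q <= n1], the first q entries of [I1] followed by entry [n1] form an increasing tuple. It
       has the type of entries 0 to q of [I0], which are the entries of [I] along [u] followed by
       [I i]. *)
    pose w1 (y : 'I_q.+1) := if (y < q)%N then nat_of_ord y else n1.
    have ew : eqtp A (subtuple I1 w1) (subtuple I0 (@nat_of_ord q.+1)).
      apply: (eqtp_trans (b := subtuple I1 (@nat_of_ord q.+1))).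
        move/(indiscP LU): G1.1; apply=> // x y xy; rewrite /w1.
        by case: ifP => xq; case: ifP => yq /=; have := ltn_ord x; have := ltn_ord y; lia.
      have := same_lstp_eqtp LU G1.2.
      move=> /(eqtp_map LU (e := fun a (z : 'I_q.+1 * X) => a (nat_of_ord z.1, z.2))); apply.
      by move=> z; exact: (coord_var _ _ (nat_of_ord z.1, z.2)).
    pose ee (a : tup (fun z : 'I_q.+1 * X => s z.2)) : tup (cat_srt s (fun z : 'I_q * X => s z.2)) :=
      cat_tup (fun x => a (ord_max, x)) (fun z => a (widen_ord (leqnSn q) z.1, z.2)).
    have -> : cat_tup (I1 n1) (subtuple I (fun y : 'I_q => f0 y)) = ee (subtuple I1 w1).
      apply: functional_extensionality_dep => -[x|[y x]]; rewrite /ee /subtuple /= /w1 /=.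
        by rewrite ltnn.
      by rewrite ltn_ord ag1.
    have -> : cat_tup (I i) (subtuple I (fun y : 'I_q => f0 y)) = ee (subtuple I0 (@nat_of_ord q.+1)).
      apply: functional_extensionality_dep => -[x|[y x]] //; rewrite /ee /subtuple /= /I0 /f0.
      by rewrite ltnn subnn h00.
    apply: (eqtp_map LU _ ew) => -[x|[y x]] /=; first exact: (coord_var _ _ (ord_max, x)).
    exact: (coord_var _ _ (widen_ord (leqnSn q) y, x)).
  (* At this entry [F j] is at least [r - e], and [2 * ej j < r] with [e <= ej j] makes this exceed
     e. *)
  have [r stj] := st1 _ (List.in_map F _ _ (In_enum j)).
  have eej : e <= ej j by apply: eP; exact: codom_f.
  have rj := (ejP j).2 _ sp0 _ _ _ G1 (stable_le eej stj).
  have := stj _ G1 (fun _ _ => erefl) _ (leqnn _).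
  rewrite ler_norml => /andP[] ? ?; lra.
have [j Fj0] : exists j, F j c = 0.
  by apply: cover => ph ph0; exact: (cP (inl (exist _ ph ph0))).
by have := cP (inr j); rewrite /P Fj0 leNgt e0.
Qed.

End SpecialMorley.

(** * Morley sequences are Lascar special *)

Section LascarInvariance.
Context {R : realType} {U : semantics R} (LU : logic U).
Context (K : Type) (hK : uncountable_strong_limit K).
Context (satU : @saturated R U K) (homU : @strongly_homogeneous R U K).
Context (depU : @dependent R U K).
Context (A : set (elt U)) (sA : small K A).
Context (X : Type) (s : X -> sem_sort U) (sX : small K [set: X]).

Lemma formula_reindex Y (s' : Y -> sem_sort U) Z (sz : Z -> sem_sort U)
    (phi : formula sz) (e : tup s' -> tup sz) :
  (forall z, coordinate set0 (fun a => e a z)) ->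
  exists psi : formula s', forall a, value psi a = value phi (e a).
Proof.
move=> ce; have [l /(_ _ s' (fun a b => a = e b))] := val_subst LU phi.
case=> [z _|psi psiP]; last by exists psi => a; exact: psiP.
have [[y|[p []]] [h hP]] := coordP (ce z).
by exists y, h => a a' ->; exact: hP.
Qed.

(** Conditions phi(x, b) with finite b, packed so that parameter tuples of different lengths and
    sorts can occur in one list. *)
Definition pformula : Type :=
  {k : nat & {t : 'I_k -> sem_sort U & (formula (cat_srt s t) * tup t)%type}}.

Definition pvalue (q : pformula) (a : tup s) : R :=
  value (projT2 (projT2 q)).1 (cat_tup a (projT2 (projT2 q)).2).

Definition pdivides (q : pformula) : Prop :=
  divides A (projT2 (projT2 q)).1 (projT2 (projT2 q)).2.

Lemma nonforking_avoid (B : set (elt U)) (p : set (formula_over B s)) (L : seq pformula) :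
  ~ forks A p -> (forall q, List.In q L -> pdivides q) ->
  exists c, realizes c p /\ forall q, List.In q L -> pvalue q c <> 0.
Proof.
move=> nf dL; apply: contrapT => nc; apply: nf.
have tL (i : 'I_(size L)) : List.In (tnth (in_tuple L) i) L.
  have [x0 ->] : exists x0, tnth (in_tuple L) i = nth x0 L i.
    by exists (tnth (in_tuple L) i); exact: tnth_nth.
  case: i => i /=; elim: {dL nc} L i => //= q L IH [|i] iL; first by left.
  by right; exact: IH.
exists (size L), (fun i => projT1 (tnth (in_tuple L) i)),
  (fun i => projT1 (projT2 (tnth (in_tuple L) i))),
  (fun i => (projT2 (projT2 (tnth (in_tuple L) i))).1),
  (fun i => (projT2 (projT2 (tnth (in_tuple L) i))).2).
split=> [j|c cp]; first exact: dL.
apply: contrapT => nj; apply: nc; exists c; split=> // q qL q0; apply: nj.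
have [i iq] : exists i, tnth (in_tuple L) i = q; last by move: q0; rewrite -iq; exists i.
have [i iL iq] : exists2 i, (i < size L)%N & nth q L i = q.
  elim: {dL tL} L qL => //= x L IH [->|/IH[i iL iq]]; first by exists 0%N.
  by exists i.+1.
by exists (Ordinal iL); rewrite (tnth_nth q).
Qed.

(* By dependence, |phi(a, J_(2i)) - phi(a, J_(2i+1))| cannot stay above [e] along
   an indiscernible sequence [J] that starts with [u], [v]. *)
Lemma lascar1_divides n (t : 'I_n -> sem_sort U) (u v : tup t)
    (phi : formula (cat_srt s t)) (e : R) :
  0 < e -> lascar1 A u v -> exists q, pdivides q /\
    forall a, e <= `|value phi (cat_tup a u) - value phi (cat_tup a v)| -> pvalue q a = 0.
Proof.
move=> e0 [J [hJ J0 J1]].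
have [|phi1 phi1P] := @formula_reindex _ (cat_srt s (cat_srt t t)) _ _ phi
  (fun a => cat_tup (fun x => a (inl x)) (fun i => a (inr (inl i)))).
  by move=> [x|i]; [exact: (coord_var _ _ (inl x))|exact: (coord_var _ _ (inr (inl i)))].
have [|phi2 phi2P] := @formula_reindex _ (cat_srt s (cat_srt t t)) _ _ phi
  (fun a => cat_tup (fun x => a (inl x)) (fun i => a (inr (inr i)))).
  by move=> [x|i]; [exact: (coord_var _ _ (inl x))|exact: (coord_var _ _ (inr (inr i)))].
have [psi psiP] := val_dist_ge LU phi1 phi2 e.
(* The doubled parameter context is a sum type; cutting it down gives the finite ordinal index that
   [pformula] requires. *)
have [m [g [psi' psi'P]]] := value_fin_right LU psi.
have valP a (w1 w2 : tup t) : value psi' (cat_tup a (fun i => cat_tup w1 w2 (g i))) = 0 <->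
    e <= `|value phi (cat_tup a w1) - value phi (cat_tup a w2)|.
  by rewrite -psi'P psiP phi1P phi2P.
exists (existT _ m (existT _ _ (psi', fun i => cat_tup u v (g i)))); split; last by move=> a /valP.
pose rho i (q : 'I_2) : nat := (i.*2 + q)%N.
have hrows : indiscernible A ltn (fun i => subtuple J (rho i)).
  apply: (rows_indisc LU (O := nat)) => // [i q q'|i j q q' ij].
    by rewrite !ltEnat /rho /= ltn_add2l.
  by rewrite ltEnat /rho /=; have := ltn_ord q; have := ltn_ord q'; lia.
pose pr (a : tup (fun z : 'I_2 * 'I_n => t z.2)) : tup (cat_srt t t) :=
  cat_tup (fun y => a (ord0, y)) (fun y => a (ord_max, y)).
have cpr w : coordinate A (fun a => pr a w).
  case: w => y; first exact: (coord_var A (fun z : 'I_2 * 'I_n => t z.2) (ord0, y)).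
  exact: (coord_var A (fun z : 'I_2 * 'I_n => t z.2) (ord_max, y)).
exists (fun i => (fun j => pr (subtuple J (rho i)) (g j))); split.
- apply: (indisc_map LU (e := fun a j => pr a (g j))) hrows => j.
  exact: cpr.
- by apply: functional_extensionality_dep => j; rewrite /pr /subtuple /rho /= J0 J1.
- move=> [c cP].
  have [|phi' phi'P] := @formula_reindex _ (cat_srt t s) _ _ phi
    (fun a => cat_tup (fun x => a (inr x)) (fun i => a (inl i))).
    by move=> [x|i]; [exact: (coord_var _ _ (inr x))|exact: (coord_var _ _ (inl i))].
  have [l lP] := nip_cvg LU hK depU phi' c (small_ord hK n) sX hJ.
  have e2 : 0 < e / 2 by rewrite divr_gt0.
  have [i0 i0P] := lP _ e2.
  have /valP := cP i0; rewrite /subtuple /= /rho /= addn0 addn1.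
  have := i0P i0.*2; have := i0P i0.*2.+1; rewrite !phi'P => /(_ _)/wrap[]; first by lia.
  move=> h1 /(_ _)/wrap[]; first by lia.
  move: h1; rewrite !ltr_norml !ler_normr => /andP[] ? ? /andP[] ? ? /orP[] ?; lra.
Qed.

Definition lascar_invariant (B : set (elt U)) (c : tup s) : Prop :=
  forall n (t : 'I_n -> sem_sort U) (u v : tup t) (phi : formula (cat_srt s t)),
    (forall i, B (existT _ (t i) (u i))) -> (forall i, B (existT _ (t i) (v i))) ->
    lascar1 A u v -> value phi (cat_tup c u) = value phi (cat_tup c v).

Lemma lascar_invariant_subset B B' c :
  B `<=` B' -> lascar_invariant B' c -> lascar_invariant B c.
Proof. by move=> BB' h n t u v phi uB vB; apply: h => i; exact: BB'. Qed.

Lemma lascar_invariant_realization (B : set (elt U)) (J : Type) (P : J -> tup s -> Prop) :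
  small K B -> (forall j, closed_cond B (P j)) ->
  (forall (l : seq J) (L : seq pformula), (forall q, List.In q L -> pdivides q) ->
     exists a, (forall j, List.In j l -> P j a) /\
       forall q, List.In q L -> pvalue q a <> 0) ->
  exists c, (forall j, P j c) /\ lascar_invariant B c.
Proof.
move=> sB cP fin.
(* All closed conditions whose failure forces a dividing condition. Those expressing Lascar
   invariance up to an error belong here by [lascar1_divides], and any finitely many of them hold
   wherever the corresponding dividing conditions are avoided. *)
pose J' := {C : tup s -> Prop | closed_cond B C /\
  exists q, pdivides q /\ forall a, ~ C a -> pvalue q a = 0}.
pose P' (j : J + J') a := match j with inl j => P j a | inr C => sval C a end.
have [|l|c cP'] := @compactness _ _ _ satU B _ s _ P' sB sX.
- by move=> [j|C]; [exact: cP|exact: (svalP C).1].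
- have [l1 [l2 [L [dL lP]]]] : exists (l1 : seq J) (l2 : seq J') (L : seq pformula),
      (forall q, List.In q L -> pdivides q) /\
      forall a, (forall j, List.In j l1 -> P j a) -> (forall q, List.In q L -> pvalue q a <> 0) ->
        forall j, List.In j l -> P' j a.
    elim: l => [|j l [l1 [l2 [L [dL lP]]]]]; first by exists [::], [::], [::].
    case: j => [j|[C [cC [q [dq qC]]]]].
      exists (j :: l1), l2, L; split=> // a h1 h2 j' [<-|j'l]; first by apply: h1; left.
      by apply: lP => // k kl; apply: h1; right.
    exists l1, l2, (q :: L); split; first by move=> q' [<-|/dL].
    move=> a h1 h2 j' [<-|j'l] /=.
      by apply: contrapT => /qC; apply: h2; left.
    by apply: lP => // q' q'L; apply: h2; right.
  have [a [a1 a2]] := fin l1 L dL; exists a; exact: lP.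
exists c; split; first by move=> j; exact: (cP' (inl j)).
move=> n t u v phi uB vB uv; apply/eqP; rewrite -subr_eq0 -normr_le0.
apply/ler_addgt0Pl => e e0; rewrite addr0.
pose C (a : tup s) : Prop := `|value phi (cat_tup a u) - value phi (cat_tup a v)| <= e.
have CJ : closed_cond B C /\ exists q, pdivides q /\ forall a, ~ C a -> pvalue q a = 0.
  split.
    apply: (cond_dist_le LU); apply: (definable_value LU) => -[x|i] /=;
      by [exact: coord_var|exact: coord_par].
  have [q [dq qP]] := lascar1_divides phi e0 uv; exists q; split=> // a nC; apply: qP.
  by rewrite leNgt; apply/negP => h; apply: nC; exact: ltW.
exact: (cP' (inr (exist _ C CJ))).
Qed.

(** Appending parameters from [A] and restricting to a finite subtuple both preserve [lascar1], so
    invariance, defined with finite tuples, reaches arbitrary tuples and formulas over [A]. *)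
Lemma lascar1_invariant_eqtp B Y (s' : Y -> sem_sort U) (a b : tup s') c :
  A `<=` B -> (forall y, B (existT _ (s' y) (a y))) -> (forall y, B (existT _ (s' y) (b y))) ->
  lascar1 A a b -> lascar_invariant B c -> eqtp A (cat_tup c a) (cat_tup c b).
Proof.
move=> AB aB bB ab hc f [phi phiP].
have [|phi' phi'P] := @formula_reindex _ (cat_srt s (cat_srt s' (@par_srt R U A))) _ _ phi
  (fun w => cat_tup (cat_tup (fun x => w (inl x)) (fun y => w (inr (inl y))))
                    (fun p => w (inr (inr p)))).
  move=> [[x|y]|p].
  - exact: (coord_var _ _ (inl x)).
  - exact: (coord_var _ _ (inr (inl y))).
  - exact: (coord_var _ _ (inr (inr p))).
have fE a' : f (cat_tup c a') = value phi' (cat_tup c (cat_tup a' (@par_val R U A))).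
  by rewrite -phiP phi'P.
have [n [g [psi psiP]]] := value_fin_right LU phi'.
rewrite !fE !psiP; apply: hc.
- by move=> i; case: (g i) => [y|[[t m] Am]] /=; [exact: aB|exact: AB].
- by move=> i; case: (g i) => [y|[[t m] Am]] /=; [exact: bB|exact: AB].
apply: (lascar1_map LU (e := fun a i => cat_tup a (@par_val R U A) (g i))) ab => i.
by case: (g i) => [y|[[t m] Am]] /=; [exact: coord_var|exact: coord_par].
Qed.

(** A chain of Lascar steps passes through intermediate tuples; these are put into [B], so that
    invariance of [c] applies at every step. *)
Lemma same_lstp_invariant Y (s' : Y -> sem_sort U) (a b : tup s') :
  small K [set: Y] -> same_lstp A a b ->
  exists B, small K B /\ forall c, lascar_invariant B c -> eqtp A (cat_tup c a) (cat_tup c b).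
Proof.
move=> sY; elim=> [x y xy|x|x y _ [B [sB h]]|x y z _ [B [sB h]] _ [B' [sB' h']]].
- pose r (w : tup s') : set (elt U) := range (fun y => existT _ (s' y) (w y)).
  have sr w : small K (r w) by apply: (small_image sY (f := fun y => existT _ (s' y) (w y))).
  exists (A `|` (r x `|` r y)); split; first by do 2 apply: small_setU => //.
  move=> c; apply: lascar1_invariant_eqtp xy; first by move=> p; left.
    by move=> w; right; left; exists w.
  by move=> w; right; right; exists w.
- by exists set0; split=> //; apply: small_subset sA.
- by exists B; split=> // c /h/eqtp_sym.
exists (B `|` B'); split; first exact: small_setU.
move=> c hc; apply: (eqtp_trans (b := cat_tup c y)).
  by apply: h; apply: lascar_invariant_subset hc => p; left.
by apply: h'; apply: lascar_invariant_subset hc => p; right.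
Qed.

Section Endless.
Context (d : Order.disp_t) (O : orderType d) (enO : endless O).

Lemma exists_upper_bound (l : seq O) : exists o, forall x, x \in l -> (x < o)%O.
Proof.
elim: l => [|x l [u uP]]; first by case: enO => -[u] _; exists u.
have [u' uu'] := enO.2 (Order.max x u); exists u' => y; rewrite inE => /orP[/eqP->|/uP yu].
  by apply: le_lt_trans uu'; rewrite le_max lexx.
by apply: (lt_trans yu); apply: le_lt_trans uu'; rewrite le_max lexx orbT.
Qed.

(** The two tuples may interleave, so they need not start a common sequence of blocks. Each of them
    does so with a block lying above both. *)
Lemma lascar_common_tail (I : O -> tup s) n (f g : 'I_n -> O) :
  indiscernible A <%O I ->
  increasing (fun i j : 'I_n => (i < j)%N) <%O f ->
  increasing (fun i j : 'I_n => (i < j)%N) <%O g ->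
  exists h : 'I_n -> O,
    lascar1 A (subtuple I f) (subtuple I h) /\ lascar1 A (subtuple I g) (subtuple I h).
Proof.
move=> hI fi gi.
have [u uP] := exists_upper_bound (codom f ++ codom g).
have [H [H0 Hi]] := exists_above enO u.
(* Only row 0 depends on [f]; the later rows are consecutive blocks of length n in [H], hence shared
   by both tuples. *)
pose rho (f : 'I_n -> O) (i : nat) (q : 'I_n) : O :=
  if i is i'.+1 then H (i' * n + q)%N else f q.
have oH k : (u <= H k)%O by rewrite -H0 le_eqVlt; case: k => [|k]; [rewrite eqxx|rewrite Hi ?orbT].
have key f' : increasing (fun i j : 'I_n => (i < j)%N) <%O f' -> (forall i, (f' i < u)%O) ->
    lascar1 A (subtuple I f') (subtuple I (rho f' 1%N)).
  move=> fi' fo; apply: (rows_lascar LU (rho := rho f')) => //.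
    by move=> [|i] q q' qq /=; [exact: fi'|apply: Hi; rewrite ltn_add2l].
  move=> [|i] [|j] q q' //= ij; first exact: lt_le_trans (fo q) (oH _).
  apply: Hi; have := ltn_ord q; move: ij; rewrite ltnS => ij qn.
  have : (i.+1 * n <= j * n)%N by rewrite leq_mul2r ij orbT.
  by rewrite mulSn; lia.
exists (rho f 1%N); split; first by apply: key => // i; apply: uP; rewrite mem_cat codom_f.
by apply: (key g) => // i; apply: uP; rewrite mem_cat codom_f orbT.
Qed.

Lemma lascar_invariant_indisc (I : O -> tup s) B n (f g : 'I_n -> O) c :
  indiscernible A <%O I -> A `<=` B -> (forall o x, B (existT _ (s x) (I o x))) ->
  increasing (fun i j : 'I_n => (i < j)%N) <%O f ->
  increasing (fun i j : 'I_n => (i < j)%N) <%O g ->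
  lascar_invariant B c -> eqtp A (cat_tup c (subtuple I f)) (cat_tup c (subtuple I g)).
Proof.
move=> hI AB IB fi gi hc; have [h [fh gh]] := lascar_common_tail hI fi gi.
apply: (eqtp_trans (b := cat_tup c (subtuple I h))).
  by apply: lascar1_invariant_eqtp fh hc => // -[i x]; exact: IB.
by apply: eqtp_sym; apply: lascar1_invariant_eqtp gh hc => // -[i x]; exact: IB.
Qed.

End Endless.

End LascarInvariance.

(** * Continuing two sequences by one Lascar invariant point *)

Section MorleySpecial.
Context {R : realType} {U : semantics R} (LU : logic U).
Context (K : Type) (hK : uncountable_strong_limit K).
Context (satU : @saturated R U K) (homU : @strongly_homogeneous R U K).
Context (depU : @dependent R U K).
Context (A : set (elt U)) (sA : small K A).
Context (X : Type) (s : X -> sem_sort U) (sX : small K [set: X]).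

Lemma app_surj g Y (s' : Y -> sem_sort U) (a : tup s') :
  aut_over A g -> exists b : tup s', app g b = a.
Proof.
move=> [ag _].
have h y : {m | g _ m = a y}.
  by apply: cid; have [k _ gk] := aut_bij LU ag (s' y); exists (k (a y)).
exists (fun y => projT1 (h y)); apply: functional_extensionality_dep => y.
exact: projT2 (h y).
Qed.

Lemma divides_app g k (t : 'I_k -> sem_sort U) (phi : formula (cat_srt s t)) (b : tup t) :
  aut_over A g -> divides A phi b -> divides A phi (app g b).
Proof.
move=> ag [J [hJ J0 nJ]]; exists (fun i => app g (J i)); split.
- exact: (indisc_app LU ag).
- by rewrite J0.
move=> [c cP]; apply: nJ; have [c' c'c] := app_surj c ag; exists c' => i.
by rewrite -(cP i) -(aut_value LU ag.1 phi) -/(app g _) app_cat c'c.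
Qed.

(* A finite part of the conditions on [c] only mentions I1_u for finitely many u;
   an automorphism over A moves I1_u into I, where a nonforking realization of
   the type of the next entry of I satisfies them. *)
Lemma append_extension d (O : orderType d) (I : O -> tup s)
    d1 (O1 : orderType d1) (I1 : O1 -> tup s) (f1 : nat -> O1) (g1 : nat -> O) B :
  indiscernible A <%O I -> morley A I -> increasing ltn <%O g1 ->
  indiscernible A <%O I1 -> increasing ltn <%O f1 ->
  same_lstp A (subtuple I1 f1) (subtuple I g1) ->
  small K B -> A `<=` B -> (forall o x, B (existT _ (s x) (I1 o x))) ->
  exists c, indiscernible A (lt_last <%O) (append I1 c) /\ lascar_invariant A B c.
Proof.
move=> hI [_ mor] g1i hI1 f1i l1 sB AB I1B.
have e1 n (w : 'I_n -> O) (w1 : 'I_n -> O1) :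
    increasing (fun i j : 'I_n => (i < j)%N) <%O w ->
    increasing (fun i j : 'I_n => (i < j)%N) <%O w1 ->
    eqtp A (subtuple I1 w1) (subtuple I w).
  move=> wi w1i.
  apply: (eqtp_trans (b := subtuple I1 (f1 \o @nat_of_ord n))).
    by move/(indiscP LU): hI1; apply=> // i j ij; exact: f1i.
  apply: (eqtp_trans (b := subtuple I (g1 \o @nat_of_ord n))).
    have := same_lstp_eqtp LU l1.
    move=> /(eqtp_map LU (e := fun a (z : 'I_n * X) => a (nat_of_ord z.1, z.2))); apply.
    by move=> z; exact: (coord_var _ _ (nat_of_ord z.1, z.2)).
  by move/(indiscP LU): hI; apply=> // i j ij; exact: g1i.
pose J := {n : nat & ({h : 'I_n -> option O1 |
    increasing (fun i j : 'I_n => (i < j)%N) (lt_last <%O) h} *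
  {f : tup (fun z : 'I_n * X => s z.2) -> R | definable A f})%type}.
(* Equality with the value on the first n entries along [f1], written as a distance condition;
   together these say that [I1] followed by a has the EM-type of [I1]. *)
pose P (j : J) (a : tup s) : Prop :=
  `|sval (projT2 j).2 (subtuple (append I1 a) (sval (projT2 j).1)) -
    sval (projT2 j).2 (subtuple I1 (f1 \o @nat_of_ord _))| <= 0.
have [||c [cP hc]] := @lascar_invariant_realization _ _ LU K hK satU depU A _ s sX B J P sB.
- move=> [n [[h hi] [f df]]]; apply: (cond_dist_le LU).
    apply: (definable_comp LU (definable_mono LU AB df)) => -[i x]; rewrite /subtuple /=.
    by case: (h i) => [u|]; [exact: coord_par (I1B u x)|exact: coord_var].
  apply: (definable_comp LU (definable_mono LU AB df)) => -[i x]; rewrite /subtuple /=.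
  exact: coord_par (I1B _ x).
- move=> l L dL.
  pose G (j : J) : seq O1 := pmap id (codom (sval (projT2 j).1)).
  pose u := sort <=%O (undup (flatten (map G l))); pose q := size u.
  have su : sorted <%O u by rewrite sort_lt_sorted undup_uniq.
  have Gu j o : List.In j l -> o \in G j -> o \in u.
    by move=> jl oG; rewrite mem_sort mem_undup; exact: mem_flatten_In oG.
  pose U1 (y : 'I_q) := tnth (in_tuple u) y.
  have U1i : increasing (fun i j : 'I_q => (i < j)%N) <%O U1.
    move=> i j ij; rewrite /U1 !(tnth_nth (U1 i)) /=.
    by rewrite (sorted_ltn_nth lt_trans) ?inE ?ltn_ord.
  have g1i' : increasing (fun i j : 'I_q => (i < j)%N) <%O (g1 \o @nat_of_ord q).
    by move=> i j ij; exact: g1i.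
  have [g [ag gE]] := homogeneous LU hK homU sA (small_prod hK (small_ord hK q) sX) (e1 _ _ _ g1i' U1i).
  have gI o : o \in u -> app g (I1 o) = I (g1 (index o u)).
    move=> ou; apply: functional_extensionality_dep => x.
    have yo : (index o u < q)%N by rewrite index_mem.
    have := congr1 (fun h : tup (fun z : 'I_q * X => s z.2) => h (Ordinal yo, x)) gE.
    rewrite /subtuple /app /=.
    by rewrite /U1 (tnth_nth o) /= nth_index.
  pose L' : seq (pformula s) := [seq (existT _ (projT1 q) (existT _ (projT1 (projT2 q))
    ((projT2 (projT2 q)).1, app g (projT2 (projT2 q)).2)) : pformula s) | q <- L].
  (* [g1 q] comes after all indices matched with [u], so those entries of [I] are among the
     parameters of this type. The dividing conditions are moved by [g] as well, and [a'] is then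
     pulled back. *)
  have [|a' [a'p a'L]] := nonforking_avoid (L := L') (mor (g1 q)).
    move=> _ /List.in_map_iff[p [<- /dL pd]]; exact: divides_app.
  have [c gc] := app_surj a' ag.
  exists c; split; last first.
    move=> p pL; have := a'L _ (List.in_map _ _ _ pL); rewrite /pvalue /=.
    by rewrite -gc -app_cat (aut_value LU ag.1 (projT2 (projT2 p)).1).
  move=> [n [[h hi] [f df]]] jl; rewrite /P /=.
  pose z (a : tup s) : tup (fun z : 'I_n * X => s z.2) := fun y =>
    if h y.1 is Some o then I (g1 (index o u)) y.2 else a y.2.
  have hu i o : h i = Some o -> o \in u.
    move=> hio; apply: Gu jl _; rewrite /G /= mem_pmap map_id.
    by apply/codomP; exists i.
  have -> : f (subtuple (append I1 c) h) = f (z a').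
    rewrite -(aut_eqtp LU (subtuple (append I1 c) h) ag df); congr f.
    apply: functional_extensionality_dep => -[i x]; rewrite /app /subtuple /z /=.
    case hio: (h i) => [v|] /=; last by rewrite -gc.
    by rewrite -gI//; exact: hu hio.
  have -> : f (z a') = f (z (I (g1 q))).
    apply: (realizes_eqtp LU a'p (f := fun a => f (z a))).
    apply: (definable_comp LU (definable_mono LU _ df)); first by move=> p; left.
    move=> [i x]; rewrite /z /=; case hio: (h i) => [v|]; last exact: coord_var.
    apply: coord_par; right; exists (g1 (index v u)), x; split=> //; apply: g1i => /=.
    by rewrite index_mem; exact: hu hio.
  pose w i := g1 (if h i is Some o then index o u else q).
  have wi : increasing (fun i j : 'I_n => (i < j)%N) <%O w.
    move=> i j ij; apply: g1i => /=; move: (hi _ _ ij).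
    case hio: (h i) => [v|] //=; case hjo: (h j) => [v'|] //= oo.
      by apply: index_sorted_lt => //; [exact: sort_le_sorted|exact: hu hio|exact: hu hjo].
    by rewrite index_mem; exact: hu hio.
  have -> : z (I (g1 q)) = subtuple I w.
    apply: functional_extensionality_dep => -[i x]; rewrite /z /subtuple /w /=.
    by case: (h i).
  rewrite -(e1 _ _ (f1 \o @nat_of_ord n) wi _ _ df); last by move=> i j ij; exact: f1i.
  by rewrite subrr normr0.
exists c; split=> //; apply/(indiscP LU) => n h h' hi hi' f df.
have key h0 (h0i : increasing (fun i j : 'I_n => (i < j)%N) (lt_last <%O) h0) :
    f (subtuple (append I1 c) h0) = f (subtuple I1 (f1 \o @nat_of_ord _)).
  have := cP (existT _ n (exist _ h0 h0i, exist _ f df)).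
  by rewrite /P /= normr_le0 subr_eq0 => /eqP.
by rewrite !key.
Qed.

Lemma morley_lascar_special d (O : orderType d) (I : O -> tup s) :
  small K [set: O] -> endless O -> indiscernible A <%O I -> morley A I -> lascar_special K A I.
Proof.
move=> sO enO hI mor; split=> // d1 d2 O1 O2 I1 I2.
move=> [sO1 en1 hI1 [f1 [g1 [f1i g1i l1]]]] [sO2 en2 hI2 [f2 [g2 [f2i g2i l2]]]].
have sNX : small K [set: nat * X] by exact: (small_prod hK (small_nat hK) sX).
have [B1 [sB1 B1P]] := same_lstp_invariant LU hK sA s sNX l1.
have [B2 [sB2 B2P]] := same_lstp_invariant LU hK sA s sNX l2.
pose r d (O : orderType d) (I : O -> tup s) : set (elt U) :=
  range (fun z : O * X => existT _ (s z.2) (I z.1 z.2)).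
have sr d' (O' : orderType d') (I' : O' -> tup s) : small K [set: O'] -> small K (r _ _ I').
  move=> sO'; apply: (small_image (small_prod hK sO' sX)
    (f := fun z : O' * X => existT _ (s z.2) (I' z.1 z.2))) => //.
pose B := A `|` (B1 `|` (B2 `|` (r _ _ I `|` (r _ _ I1 `|` r _ _ I2)))).
have sB : small K B by do ![apply: (small_setU hK) => //|exact: sr].
have AB : A `<=` B by move=> p; left.
have IB o x : B (existT _ (s x) (I o x)) by do 3 right; left; exists (o, x).
have I1B o x : B (existT _ (s x) (I1 o x)) by do 4 right; left; exists (o, x).
have I2B o x : B (existT _ (s x) (I2 o x)) by do 5 right; exists (o, x).
have [c [hc cB]] := append_extension hI mor g1i hI1 f1i l1 sB AB I1B.
exists c; split=> //.
have cB1 := B1P c (lascar_invariant_subset (fun p (h : B1 p) => or_intror (or_introl h)) cB).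
have cB2 := B2P c (lascar_invariant_subset (fun p (h : B2 p) => or_intror (or_intror (or_introl h))) cB).
have sub n d3 (O3 : orderType d3) (I3 : O3 -> tup s) (f3 : nat -> O3)
    d4 (O4 : orderType d4) (I4 : O4 -> tup s) (f4 : nat -> O4) :
    eqtp A (cat_tup c (subtuple I3 f3)) (cat_tup c (subtuple I4 f4)) ->
    eqtp A (cat_tup c (subtuple I3 (f3 \o @nat_of_ord n)))
           (cat_tup c (subtuple I4 (f4 \o @nat_of_ord n))).
  pose e (a : tup (cat_srt s (fun z : nat * X => s z.2))) :
      tup (cat_srt s (fun z : 'I_n * X => s z.2)) :=
    cat_tup (fun x => a (inl x)) (fun z => a (inr (nat_of_ord z.1, z.2))).
  move=> /(eqtp_map LU (e := e)); apply=> -[x|z]; first exact: (coord_var _ _ (inl x)).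
  exact: (coord_var _ _ (inr (nat_of_ord z.1, z.2))).
(* Over [c] the chain runs from [I2] along h to [I2] along f2, to [I] along g2, to [I] along g1, to
   [I1] along f1. Moves within one sequence use [lascar_invariant_indisc]; changes of sequence use
   [cB2] and [cB1]. *)
have main n (h : 'I_n -> O2) : increasing (fun i j : 'I_n => (i < j)%N) <%O h ->
    eqtp A (cat_tup c (subtuple I2 h)) (cat_tup c (subtuple I1 (f1 \o @nat_of_ord n))).
  move=> hi.
  apply: (eqtp_trans (b := cat_tup c (subtuple I2 (f2 \o @nat_of_ord n)))).
    apply: (lascar_invariant_indisc LU en2 hI2 AB I2B hi _ cB) => i j ij; exact: f2i.
  apply: (eqtp_trans (sub _ _ _ _ _ _ _ _ _ cB2)).
  apply: (eqtp_trans (b := cat_tup c (subtuple I (g1 \o @nat_of_ord n)))).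
    by apply: (lascar_invariant_indisc LU enO hI AB IB _ _ cB) => i j ij; [exact: g2i|exact: g1i].
  exact/eqtp_sym/sub.
have key n (f : 'I_n -> option O2) : increasing (fun i j : 'I_n => (i < j)%N) (lt_last <%O) f ->
    exists f' : 'I_n -> option O1, increasing (fun i j : 'I_n => (i < j)%N) (lt_last <%O) f' /\
      eqtp A (subtuple (append I2 c) f) (subtuple (append I1 c) f').
  move=> fi; exists (fun i => if f i is Some _ then Some (f1 i) else None); split.
    by move=> i j ij; move: (fi _ _ ij); case: (f i) => // o; case: (f j) => //= o' _; exact: f1i.
  have [ub ubP] := exists_upper_bound en2 (pmap id (codom f)).
  (* [None] can only be the last value of f. There h takes an index above all others, which keeps it
     increasing, and [ee] replaces that entry by [c]. *)
  pose h i := if f i is Some o then o else ub.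
  have hi : increasing (fun i j : 'I_n => (i < j)%N) <%O h.
    move=> i j ij; move: (fi _ _ ij); rewrite /h; case fio: (f i) => [v|] //=.
    case: (f j) => //= _; apply: ubP; rewrite mem_pmap map_id.
    by apply/codomP; exists i.
  pose ee (a : tup (cat_srt s (fun z : 'I_n * X => s z.2))) : tup (fun z : 'I_n * X => s z.2) :=
    fun z => if f z.1 is Some _ then a (inr (z.1, z.2)) else a (inl z.2).
  have -> : subtuple (append I2 c) f = ee (cat_tup c (subtuple I2 h)).
    apply: functional_extensionality_dep => -[i x]; rewrite /ee /subtuple /h /=.
    by case: (f i).
  have -> : subtuple (append I1 c) (fun i => if f i is Some _ then Some (f1 i) else None) =
      ee (cat_tup c (subtuple I1 (f1 \o @nat_of_ord n))).
    apply: functional_extensionality_dep => -[i x]; rewrite /ee /subtuple /=.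
    by case: (f i).
  apply: (eqtp_map LU _ (main _ _ hi)) => -[i x]; rewrite /ee /=.
  by case: (f i) => [v|]; [exact: (coord_var _ _ (inr (i, x)))|exact: (coord_var _ _ (inl x))].
apply/(indiscP LU) => n f g fi gi.
have [f' [f'i ff']] := key _ _ fi; have [g' [g'i gg']] := key _ _ gi.
apply: (eqtp_trans ff'); apply: eqtp_trans (eqtp_sym gg').
by move/(indiscP LU): hc; apply.
Qed.

End MorleySpecial.

(** * Classical and continuous logic *)

Section Terms.
Context {L : lang} (car : sorts L -> Type)
  (fint : forall f : Defs.fsym L, (forall i, car (fdom (f := f) i)) -> car (fcod f)).

Definition linked (X : Type) (s : X -> sorts L) (Y : Type) (s' : Y -> sorts L) (l : seq X)
    (E : (forall x, car (s x)) -> (forall y, car (s' y)) -> Prop) : Prop :=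
  forall x, List.In x l -> exists (y : Y) (h : s' y = s x),
    forall a a', E a a' -> a x = eq_rect (s' y) car (a' y) (s x) h.

Lemma linked_flatten (X : Type) (s : X -> sorts L) (Y : Type) (s' : Y -> sorts L)
    (n : nat) (l : 'I_n -> seq X) (E : (forall x, car (s x)) -> (forall y, car (s' y)) -> Prop) :
  linked (flatten [seq l i | i <- enum 'I_n]) E -> forall i, linked (l i) E.
Proof.
move=> lk i x xl; apply: lk; have := In_enum i; elim: (enum 'I_n) => //= j r IH.
by move=> ij; apply/List.in_app_iff; case: ij => [->|/IH]; [left|right].
Qed.

Lemma term_subst (X : Type) (s : X -> sorts L) t (u : term s t) :
  exists l : seq X, forall (Y : Type) (s' : Y -> sorts L)
    (E : (forall x, car (s x)) -> (forall y, car (s' y)) -> Prop), linked l E ->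
    exists u' : term s' t, forall a a', E a a' -> teval fint a' u' = teval fint a u.
Proof.
elim: u => [x|f v IH].
  exists [:: x] => Y s' E /(_ x (or_introl erefl))[y [h hP]].
  exists (eq_rect (s' y) (term s') (tvar s' y) (s x) h) => a a' /hP /= ->.
  by clear hP; case: _ / h.
have [l lP] := choice IH.
exists (flatten [seq l i | i <- enum 'I_(far f)]) => Y s' E /linked_flatten lk.
have v'P i := cid (lP i Y s' E (lk i)).
exists (tapp (fun i => projT1 (v'P i))) => a a' Ea /=; congr (fint _).
by apply: functional_extensionality_dep => i; exact: (projT2 (v'P i)).
Qed.

Lemma teval_hom (g : forall t, car t -> car t) :
  (forall f v, g _ (fint (f := f) v) = fint (fun i => g _ (v i))) ->
  forall (X : Type) (s : X -> sorts L) (a : forall x, car (s x)) t (u : term s t),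
    teval fint (fun x => g _ (a x)) u = g _ (teval fint a u).
Proof.
move=> gf X s a t; elim=> [//|f v IH] /=; rewrite gf; congr (fint _).
by apply: functional_extensionality_dep => i; exact: IH.
Qed.

(** The relation carried under a quantifier: both tuples receive the same new value. The bound
    variable is then linked to itself, so only the free variables in the list need a hypothesis. *)
Definition ext_link (X : Type) (s : X -> sorts L) (Y : Type) (s' : Y -> sorts L) t
    (E : (forall x, car (s x)) -> (forall y, car (s' y)) -> Prop)
    (b : forall x, car (ext s t x)) (b' : forall y, car (ext s' t y)) : Prop :=
  exists a a' m, [/\ E a a', b = ext_val a m & b' = ext_val a' m].

Lemma linked_ext (X : Type) (s : X -> sorts L) (Y : Type) (s' : Y -> sorts L) t
    (l : seq (option X)) (E : (forall x, car (s x)) -> (forall y, car (s' y)) -> Prop) :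
  linked (pmap id l) E -> linked l (@ext_link X s Y s' t E).
Proof.
move=> lk [x|] xl; last first.
  by exists None, erefl => b b' [a [a' [m [_ -> ->]]]].
have [|y [h hP]] := lk x.
  elim: l xl {lk} => //= z l IH [->|/IH] /=; first by left.
  by case: z => //= z; right.
by exists (Some y), h => b b' [a [a' [m [/hP ax -> ->]]]].
Qed.

Lemma ext_val_hom (g : forall t, car t -> car t) (X : Type) (s : X -> sorts L) t
    (a : forall x, car (s x)) (m : car t) :
  (fun o => g _ (ext_val a m o)) = ext_val (fun x => g _ (a x)) (g _ m).
Proof. by apply: functional_extensionality_dep => -[x|]. Qed.

End Terms.

Section Classical.
Context (R : realType) (L : lang) (M : structure L).

Lemma sat_subst (X : Type) (s : X -> sorts L) (phi : Defs.form s) :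
  exists l : seq X, forall (Y : Type) (s' : Y -> sorts L)
    (E : (forall x, car M (s x)) -> (forall y, car M (s' y)) -> Prop), linked l E ->
    exists psi : Defs.form s', forall a a', E a a' -> (sat psi a' <-> sat phi a).
Proof.
elim: {X} s / phi => [X s|X s t u v|X s p v|X s p [l lP] q [l' lP']|X s t p [l lP]].
- by exists [::] => Y s' E _; exists (fbot s').
- have [l lP] := term_subst (@fint L M) u; have [l' lP'] := term_subst (@fint L M) v.
  exists (l ++ l') => Y s' E lk.
  have [|u' u'P] := lP Y s' E.
    by move=> x xl; apply: lk; apply/List.in_app_iff; left.
  have [|v' v'P] := lP' Y s' E.
    by move=> x xl; apply: lk; apply/List.in_app_iff; right.
  by exists (feq u' v') => a a' Ea /=; rewrite (u'P _ _ Ea) (v'P _ _ Ea).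
- have [l lP] := choice (fun i => term_subst (@fint L M) (v i)).
  exists (flatten [seq l i | i <- enum 'I_(par p)]) => Y s' E /linked_flatten lk.
  have v'P i := cid (lP i Y s' E (lk i)).
  exists (Defs.frel (fun i => projT1 (v'P i))) => a a' Ea /=.
  have -> // : (fun i => teval (@fint L M) a' (projT1 (v'P i))) = (fun i => teval (@fint L M) a (v i)).
  by apply: functional_extensionality_dep => i; exact: (projT2 (v'P i)).
- exists (l ++ l') => Y s' E lk.
  have [|p' p'P] := lP Y s' E.
    by move=> x xl; apply: lk; apply/List.in_app_iff; left.
  have [|q' q'P] := lP' Y s' E.
    by move=> x xl; apply: lk; apply/List.in_app_iff; right.
  by exists (fimp p' q') => a a' Ea /=; rewrite (p'P _ _ Ea) (q'P _ _ Ea).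
- exists (pmap id l) => Y s' E /(linked_ext t) lk.
  have [p' p'P] := lP _ _ _ lk; exists (fall p') => a a' Ea /=.
  have Em (m : car M t) : ext_link E (ext_val a m) (ext_val a' m) by exists a, a', m.
  by split=> h m; [exact: (p'P _ _ (Em m)).1|exact: (p'P _ _ (Em m)).2].
Qed.

Lemma sat_automorphism (g : forall t, car M t -> car M t) : automorphism g ->
  forall (X : Type) (s : X -> sorts L) (phi : Defs.form s) (a : forall x, car M (s x)),
    sat phi (fun x => g _ (a x)) <-> sat phi a.
Proof.
move=> [gb gf gp] X s phi.
elim: {X} s / phi => [X s|X s t u v|X s p v|X s p IH q IH'|X s t p IH] a //=.
- rewrite !(teval_hom gf); split=> [|-> //]; exact: (bij_inj (gb t)).
- rewrite [X in _ <-> X]gp.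
  have -> // : (fun i => teval (@fint L M) (fun x => g _ (a x)) (v i)) =
    (fun i => g _ (teval (@fint L M) a (v i))).
  by apply: functional_extensionality_dep => i; exact: teval_hom.
- by rewrite IH IH'.
- split=> h m; first by rewrite -IH ext_val_hom.
  by have [k _ gk] := gb t; rewrite -(gk m) -ext_val_hom IH.
Qed.

Lemma truth_value0 (P : Prop) : (if `[< P >] then 0 else 1 : R) = 0 <-> P.
Proof. by case: asboolP => h; split=> // /eqP; rewrite oner_eq0. Qed.

Lemma classical_logic : logic (classical_sem R M).
Proof.
split=> /=.
- by move=> X s phi a; case: ifP; rewrite !lexx !ler01.
- move=> X s phi; have [l lP] := sat_subst phi; exists l => Y s' E lk.
  have [psi psiP] := lP Y s' E lk; exists psi => a a' /psiP h.
  by congr (if _ then _ else _); apply/asboolP/asboolP => /h.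
- move=> X s; exists (fimp (fbot s) (fbot s)) => a; exact/truth_value0.
- move=> X s phi psi r.
  (* Distances of truth values are 0 or 1: the condition is empty for r < 0, trivial for r >= 1, and
     otherwise the equivalence of phi and psi. *)
  have [r0|r0] := ltP r 0.
    exists (fbot s) => a; rewrite truth_value0 /=; split=> // h.
    by have := le_lt_trans h r0; rewrite normr_lt0.
  have [r1|r1] := ltP r 1; last first.
    exists (fimp (fbot s) (fbot s)) => a; rewrite truth_value0 /=; split=> // _.
    by apply: le_trans r1; do 2 case: ifP => _; rewrite ?subrr ?subr0 ?sub0r ?normrN ?normr0 ?normr1.
  exists (fimp (fimp (fimp phi psi) (fimp (fimp psi phi) (fbot s))) (fbot s)) => a.
  rewrite truth_value0 /=; do 2 case: asboolP => ?;
    rewrite ?subrr ?subr0 ?sub0r ?normrN ?normr0 ?normr1 ?r0; split=> //; try tauto.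
    by rewrite leNgt r1.
  by rewrite leNgt r1.
- move=> X s phi psi r.
  (* Here the condition is trivial for r <= 0, empty for r > 1, and otherwise the negation of the
     equivalence. *)
  have [r0|r0] := leP r 0.
    exists (fimp (fbot s) (fbot s)) => a; rewrite truth_value0 /=; split=> // _.
    exact: le_trans r0 _.
  have [r1|r1] := leP r 1; last first.
    exists (fbot s) => a; rewrite truth_value0 /=; split=> //.
    by do 2 case: ifP => _; rewrite ?subrr ?subr0 ?sub0r ?normrN ?normr0 ?normr1 leNgt ?r1 ?r0.
  exists (fimp (fimp phi psi) (fimp (fimp psi phi) (fbot s))) => a.
  rewrite truth_value0 /=; do 2 case: asboolP => ?;
    rewrite ?subrr ?subr0 ?sub0r ?normrN ?normr0 ?normr1 ?r1; split=> //; try tauto.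
    by rewrite leNgt r0.
  by rewrite leNgt r0.
- by move=> g [gb _ _].
- move=> g ag X s phi a; have h := sat_automorphism ag phi a.
  by congr (if _ then _ else _); apply/asboolP/asboolP => /h.
Qed.

End Classical.

Section Continuous.
Context (R : realType) (L : mlang R) (M : mstructure L).

Lemma sup_bounds (E : set R) : E !=set0 -> (forall x, E x -> 0 <= x <= 1) -> 0 <= sup E <= 1.
Proof.
move=> [x Ex] hE; have /andP[x0 _] := hE _ Ex.
apply/andP; split; last first.
  by apply: ge_sup; [exists x|move=> y /hE/andP[]].
apply: (le_trans x0); apply: ub_le_sup => //.
by exists 1 => y /hE/andP[].
Qed.

Lemma inf_bounds (E : set R) : E !=set0 -> (forall x, E x -> 0 <= x <= 1) -> 0 <= inf E <= 1.
Proof.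
move=> [x Ex] hE; have /andP[_ x1] := hE _ Ex.
apply/andP; split; first by apply: lb_le_inf; [exists x|move=> y /hE/andP[]].
apply: le_trans x1; apply: ge_inf => //.
by exists 0 => y /hE/andP[].
Qed.

Lemma meval_bounds (X : Type) (s : X -> sorts L) (phi : mform s) (a : forall x, mcar M (s x)) :
  0 <= meval phi a <= 1.
Proof.
elim: {X} s / phi a => [X s t u v|X s p v|X s n u [_ cu] psi IH|X s t p IH|X s t p IH] a /=.
- by rewrite mdist_ge0 mcar_diam.
- exact: mpint_bounds.
- by apply: cu => i; rewrite mxE.
- apply: sup_bounds; last by move=> _ [m _ <-].
  by have [m] := mcar_inhabited M t; exists (meval p (ext_val (car := mcar M) a m)), m.
- apply: inf_bounds; last by move=> _ [m _ <-].
  by have [m] := mcar_inhabited M t; exists (meval p (ext_val (car := mcar M) a m)), m.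
Qed.

Lemma meval_subst (X : Type) (s : X -> sorts L) (phi : mform s) :
  exists l : seq X, forall (Y : Type) (s' : Y -> sorts L)
    (E : (forall x, mcar M (s x)) -> (forall y, mcar M (s' y)) -> Prop),
    linked (car := mcar M) l E ->
    exists psi : mform s', forall a a', E a a' -> meval psi a' = meval phi a.
Proof.
have tsub := term_subst (car := mcar M) (@mfint R L M).
elim: {X} s / phi => [X s t u v|X s p v|X s n u cu psi IH|X s t p [l lP]|X s t p [l lP]].
- have [l lP] := tsub _ _ _ u; have [l' lP'] := tsub _ _ _ v.
  exists (l ++ l') => Y s' E lk.
  have [|u' u'P] := lP Y s' E.
    by move=> x xl; apply: lk; apply/List.in_app_iff; left.
  have [|v' v'P] := lP' Y s' E.
    by move=> x xl; apply: lk; apply/List.in_app_iff; right.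
  by exists (mdst u' v') => a a' Ea /=; rewrite (u'P _ _ Ea) (v'P _ _ Ea).
- have [l lP] := choice (fun i => tsub _ _ _ (v i)).
  exists (flatten [seq l i | i <- enum 'I_(par p)]) => Y s' E /linked_flatten lk.
  have v'P i := cid (lP i Y s' E (lk i)).
  exists (mrel (fun i => projT1 (v'P i))) => a a' Ea /=; congr (mpint _).
  by apply: functional_extensionality_dep => i; exact: (projT2 (v'P i)).
- have [l lP] := choice IH.
  exists (flatten [seq l i | i <- enum 'I_n]) => Y s' E /linked_flatten lk.
  have psi'P i := cid (lP i Y s' E (lk i)).
  exists (mconn cu (fun i => projT1 (psi'P i))) => a a' Ea /=; congr u.
  by apply/rowP => i; rewrite !mxE; exact: (projT2 (psi'P i)).
- exists (pmap id l) => Y s' E /(linked_ext t) lk.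
  have [p' p'P] := lP _ _ _ lk; exists (msup p') => a a' Ea /=.
  congr (sup (image _ _)); apply: functional_extensionality_dep => m.
  by apply: p'P; exists a, a', m.
- exists (pmap id l) => Y s' E /(linked_ext t) lk.
  have [p' p'P] := lP _ _ _ lk; exists (minf p') => a a' Ea /=.
  congr (inf (image _ _)); apply: functional_extensionality_dep => m.
  by apply: p'P; exists a, a', m.
Qed.

Lemma range_bij (T T' V : Type) (g : T -> T') (f : T' -> V) :
  bijective g -> range (fun x => f (g x)) = range f.
Proof.
move=> [k gk kg]; apply/seteqP; split=> [_ [x _ <-]|_ [y _ <-]]; first by exists (g x).
by exists (k y) => //=; rewrite kg.
Qed.

Lemma meval_automorphism (g : forall t, mcar M t -> mcar M t) : mautomorphism g ->
  forall (X : Type) (s : X -> sorts L) (phi : mform s) (a : forall x, mcar M (s x)),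
    meval phi (fun x => g _ (a x)) = meval phi a.
Proof.
move=> [gb gd gf gp] X s phi.
have hom := teval_hom (car := mcar M) gf.
elim: {X} s / phi => [X s t u v|X s p v|X s n u cu psi IH|X s t p IH|X s t p IH] a /=.
- by rewrite !hom gd.
- rewrite [RHS]gp; congr (mpint _).
  by apply: functional_extensionality_dep => i; exact: hom.
- by congr u; apply/rowP => i; rewrite !mxE.
- congr sup; rewrite -(range_bij _ (gb t)); congr (image _ _); apply: functional_extensionality_dep => m.
  by rewrite -(ext_val_hom (car := mcar M)) IH.
- congr inf; rewrite -(range_bij _ (gb t)); congr (image _ _); apply: functional_extensionality_dep => m.
  by rewrite -(ext_val_hom (car := mcar M)) IH.
Qed.

(** Connectives must take values in [0, 1]; truncation turns any continuous function into one, with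
    zero set where the function is at most 0. *)
Definition clamp (x : R) : R := Order.min 1 (Order.max 0 x).

Lemma clamp_eq0 x : clamp x = 0 <-> x <= 0.
Proof.
rewrite /clamp; case: (lerP x 0) => x0; first by rewrite min_r ?ler01.
split=> // /eqP; rewrite eq_le => /andP[]; rewrite ge_min leNgt ltr01 /= leNgt x0 //.
Qed.

Lemma clamp_connective n (u : 'rV[R]_n -> R) : continuous u -> connective (fun v => clamp (u v)).
Proof.
move=> cu; split.
  apply: continuous_subspaceT => v; apply: (@continuous_min R _ (fun=> 1) (fun v => Order.max 0 (u v))).
    exact: cst_continuous.
  by apply: (@continuous_max R _ (fun=> 0) u); [exact: cst_continuous|exact: cu].
move=> v _; rewrite /clamp le_min ler01 le_max lexx /= ge_min lexx //.
Qed.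

Definition pair_form (X : Type) (s : X -> sorts L) (phi psi : mform s) (i : 'I_2) : mform s :=
  if i == 0 then phi else psi.

Lemma continuous_dist2 : continuous (fun v : 'rV[R]_2 => `|v 0 0 - v 0 1|).
Proof.
have c i : continuous (fun v : 'rV[R]_2 => v 0 i : R^o) by exact: coord_continuous.
move=> v; exact: (cvg_norm (cvgB (c 0 v) (c 1 v))).
Qed.

Lemma mval_dist (X : Type) (s : X -> sorts L) (phi psi : mform s) (h : R -> R) :
  continuous h -> exists chi : mform s, forall a : forall x, mcar M (s x),
    meval chi a = 0 <-> h `|meval phi a - meval psi a| <= 0.
Proof.
move=> ch.
have cu : continuous (fun v : 'rV[R]_2 => h `|v 0 0 - v 0 1|).
  move=> v; apply: (@continuous_comp _ _ _ (fun v : 'rV[R]_2 => `|v 0 0 - v 0 1|) h).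
    exact: continuous_dist2.
  exact: ch.
exists (mconn (clamp_connective cu) (pair_form phi psi)) => a /=.
by rewrite clamp_eq0 !mxE.
Qed.

Lemma continuous_logic : logic (continuous_sem M).
Proof.
split=> /=.
- exact: meval_bounds.
- exact: meval_subst.
- move=> X s.
  have c0 : continuous (fun v : 'rV[R]_0 => 0 : R) by exact: cst_continuous.
  exists (mconn (clamp_connective c0) (fun i : 'I_0 => False_rect _ (notF (ltn_ord i)))) => a /=.
  exact/clamp_eq0.
- move=> X s phi psi r; have [|chi chiP] := @mval_dist X s phi psi (fun x => x - r).
    by move=> x; apply: cvgB; [exact: cvg_id|exact: cst_continuous].
  by exists chi => a; rewrite chiP subr_le0.
- move=> X s phi psi r; have [|chi chiP] := @mval_dist X s phi psi (fun x => r - x).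
    by move=> x; apply: cvgB; [exact: cst_continuous|exact: cvg_id].
  by exists chi => a; rewrite chiP subr_le0.
- by move=> g [].
- move=> g ag X s phi a; exact: meval_automorphism.
Qed.

End Continuous.

Theorem lemma2p27 (R : realType) (K : Type) (hK : uncountable_strong_limit K) :
  (forall (L : lang) (T : set (sentence L)) (C : structure L),
     small_lang K L -> complete_theory T -> models C T ->
     monster (classical_sem R C) K -> dependent (classical_sem R C) K ->
     forall (A : set (elt (classical_sem R C))) (X : Type) (s : X -> sorts L)
       (d : Order.disp_t) (O : orderType d)
       (I : O -> tup (U := classical_sem R C) s),
       small K A -> small K [set: X] -> small K [set: O] -> endless O ->
       indiscernible A <%O I ->
       (lascar_special K A I <-> morley A I)) /\
  (forall (L : mlang R) (T : set (msentence L)) (C : mstructure L),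
     small_lang K L -> mcomplete_theory T -> mmodels C T ->
     monster (continuous_sem C) K -> dependent (continuous_sem C) K ->
     forall (A : set (elt (continuous_sem C))) (X : Type) (s : X -> sorts L)
       (d : Order.disp_t) (O : orderType d)
       (I : O -> tup (U := continuous_sem C) s),
       small K A -> small K [set: X] -> small K [set: O] -> endless O ->
       indiscernible A <%O I ->
       (lascar_special K A I <-> morley A I)).
Proof.
split=> L T C _ _ _ [satC homC] depC A X s d O I sA sX sO enO hI; split.
- exact: (lascar_special_morley (classical_logic R C)).
- exact: (morley_lascar_special (classical_logic R C)).
- exact: (lascar_special_morley (continuous_logic C)).
- exact: (morley_lascar_special (continuous_logic C)).
Qed.
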